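(* Let $M$ be an oriented 3-manifold with $\pi_1(M)=\pi_2(M)=1$, and let $CK$ be either $CK_0(M)$ or $CK_b(M)$. If $\phi\in\mathbb V_N(M)\setminus\mathbb V_{N-1}(M)$ and $[\phi]\in H^n(CK,D)$ is nontrivial, then $N=n=2k$ for some integer $k$ (here $[\phi]$ denotes the class of the cochain $\phi|_{C_n}$).
   Context: An $n$-singular knot in $M$ is an immersion $S^1\to M$ (with a chosen direction of $S^1$) which is an embedding except for $n$ transverse double points; $X_n$ is the set of these up to direction-preserving rigid-vertex isotopy. Each double point has a canonical positive and a canonical negative resolution, determined by the orientation of $M$. $X_n^0$: $n$-singular knots with double points ordered $1,\dots,n$, up to direction-preserving rigid-vertex isotopy respecting labels. $X_n^b$: $n$-singular knots with a base point apart from the double points, up to direction-preserving rigid-vertex isotopy preserving base points and keeping them apart from the double points; double points are ordered as first met from the base point. $CK$ denotes either $CK_0$ or $CK_b$: the cubical CW-complex with one $n$-cube for each element of $X_n^0$ (resp. $X_n^b$), whose cellular chain complex over $\mathbf Q$ is $C_n$ = the $\mathbf Q$-vector space with basis $X_n^0$ (resp. $X_n^b$), $\partial K_{1\ldots n}=\sum_{i=1}^n(-1)^{i+1}\mathrm d_iK_{1\ldots n}$, where $\mathrm d_iK$ is the positive minus the negative resolution at the $i$-th double point (with induced ordering/base point). $K_{1\ldots n}$ ($n\ge1$) is degenerate if $\mathrm d_iK_{1\ldots n}=0$ for some $i$; $C_n(D)\subset C_n$ is the subcomplex spanned by degenerate knots, $C_0(D)=0$. $H^n(CK,D)$ is the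 cohomology of $\mathrm{Hom}(C_*/C_*(D),\mathbf Q)$, with $\delta\phi=\phi\circ\partial$. A knot invariant $\phi:X_0\to\mathbf Q$ is extended to all singular knots by $\phi(K_\times)=\phi(K_+)-\phi(K_-)$ (inductively at each double point). $\mathbb V_n(M)$ is the vector space of invariants vanishing on all $(n+1)$-singular knots (Vassiliev invariants of order $\le n$). Forgetting ordering/base point, $\phi\in\mathbb V_N$ defines for every $n$ a cochain $\phi|_{C_n}$ on $C_n$, vanishing on $C_n(D)$; writing $[\phi]\in H^n(CK,D)$ presupposes that $\phi|_{C_n}$ is a cocycle. *)

(* Defs.v *)
From HB Require Import structures.
From Stdlib Require Import Relation_Operators.
From mathcomp.multinomials Require Import freeg.
From mathcomp Require Import all_boot all_order all_algebra generic_quotient.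
From mathcomp Require Import all_classical all_reals all_analysis.

Set Implicit Arguments.
Unset Strict Implicit.
Unset Printing Implicit Defensive.

Import Order.TTheory GRing.Theory Num.Theory.
Import numFieldNormedType.Exports.

Local Open Scope classical_set_scope.
Local Open Scope ring_scope.
Local Open Scope quotient_scope.

(* On an open set [A] of a finite-dimensional space, this is the usual
   notion "of class C^k on [A]". *)
Fixpoint class_C (R : realType) (V W : normedModType R) (k : nat)
    (A : set V) (f : V -> W) : Prop :=
  match k with
  | 0 => forall x, A x -> {for x, continuous f}
  | k'.+1 => (forall x, A x -> differentiable f x) /\
             forall v : V, class_C k' A ('D_v f)
  end.

Definition class_Coo (R : realType) (V W : normedModType R)
    (A : set V) (f : V -> W) : Prop := forall k, class_C k A f.

(* Manifolds have no boundary; [atlas_index] indexes an atlas, not nec. maximal,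
   of orientation-compatible charts. *)
Record oriented3manifold (R : realType) := Oriented3Manifold {
  carrier :> topologicalType;
  manifold_hausdorff : hausdorff_space carrier;
  manifold_countable : @second_countable carrier;
  atlas_index : Type;
  chart_dom : atlas_index -> set carrier;
  chart : atlas_index -> carrier -> 'rV[R]_3;
  chart_inv : atlas_index -> 'rV[R]_3 -> carrier;
  chart_dom_open : forall i, open (chart_dom i);
  chart_cover : forall x, exists i, chart_dom i x;
  chart_im_open : forall i, open (chart i @` chart_dom i);
  chart_invK : forall i x, chart_dom i x -> chart_inv i (chart i x) = x;
  chart_continuous : forall i x, chart_dom i x -> {for x, continuous (chart i)};
  chart_inv_continuous : forall i y, (chart i @` chart_dom i) y ->
    {for y, continuous (chart_inv i)};
  transition_smooth : forall i j,
    class_Coo (chart i @` (chart_dom i `&` chart_dom j))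
              (chart j \o chart_inv i);
  transition_oriented : forall i j x, chart_dom i x -> chart_dom j x ->
    0 < \det ('J (chart j \o chart_inv i) (chart i x))
}.

Definition smooth_map (R : realType) (M : oriented3manifold R)
    (V : normedModType R) (f : V -> M) : Prop :=
  forall z, exists i (U : set V),
    [/\ open U, U z, f @` U `<=` chart_dom i & class_Coo U (chart i \o f)].

Definition cube (R : realType) (n : nat) : set 'rV[R]_n :=
  [set x | forall j, 0 <= x ord0 j <= 1].

Definition cube_boundary (R : realType) (n : nat) : set 'rV[R]_n :=
  [set x | cube x /\ exists j, x ord0 j = 0 \/ x ord0 j = 1].
Arguments cube_boundary : clear implicits.

(* pi_n(T, x0) is trivial for every base point x0. *)
Definition pi_trivial (R : realType) (T : topologicalType) (n : nat) : Prop :=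
  forall (x0 : T) (f : 'rV[R]_n -> T),
  {within @cube R n, continuous f} ->
  (forall x, cube_boundary R n x -> f x = x0) ->
  exists H : R * 'rV[R]_n -> T,
  [/\ {within `[0, 1] `*` @cube R n, continuous H},
      forall x, cube x -> H (0, x) = f x,
      forall x, cube x -> H (1, x) = x0 &
      forall s x, 0 <= s <= 1 -> cube_boundary R n x -> H (s, x) = x0].

(* A curve S^1 -> M is a 1-periodic function R -> M, i.e. S^1 = R/Z with its
   standard direction; [same_param] is equality in R/Z. *)
Definition same_param (R : realType) (t u : R) : Prop :=
  exists z : int, u = t + z%:~R.

Section SingularKnots.
Variables (R : realType) (M : oriented3manifold R).

Definition closed_curve (c : R -> M) : Prop := forall t, c (t + 1) = c t.

Definition velocity (i : atlas_index M) (c : R -> M) (t : R) : 'rV[R]_3 :=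
  'D_1 (chart i \o c) t.

Definition immersed_curve (c : R -> M) : Prop :=
  [/\ closed_curve c, smooth_map c &
      forall t i, chart_dom i (c t) -> velocity i c t != 0].

Definition double_points (c : R -> M) : set M :=
  [set x | exists t u, [/\ ~ same_param t u, c t = x & c u = x]].

Definition no_triple_point (c : R -> M) : Prop :=
  forall t u v, c t = c u -> c u = c v ->
    [\/ same_param t u, same_param u v | same_param t v].

Definition transverse_double_points (c : R -> M) : Prop :=
  forall t u i, ~ same_param t u -> c t = c u -> chart_dom i (c t) ->
    row_free (col_mx (velocity i c t) (velocity i c u)).

(* [p] lists the double points of [c], each once. *)
Definition is_labelled_knot (n : nat) (c : R -> M) (p : 'I_n -> M) : Prop :=
  [/\ immersed_curve c, no_triple_point c, transverse_double_points c,
      injective p & range p = double_points c].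

Definition is_singular_knot (n : nat) (c : R -> M) : Prop :=
  exists p : 'I_n -> M, is_labelled_knot c p.

(* [b] is the parameter of the base point.  The last clause says that the
   labelling is the order in which the double points are first met when
   travelling along [c] from the base point. *)
Definition is_based_knot (n : nat) (c : R -> M) (p : 'I_n -> M) (b : R) : Prop :=
  [/\ is_labelled_knot c p, ~ double_points c (c b) &
      forall i j : 'I_n, (i < j)%N ->
        exists t, [/\ b <= t < b + 1, c t = p i &
          forall u, b <= u < b + 1 -> c u = p j -> t < u]].

Record singular_knot (n : nat) := SingularKnot {
  sk_curve : R -> M;
  skP : is_singular_knot n sk_curve }.

Record labelled_knot (n : nat) := LabelledKnot {
  lk_curve : R -> M;
  lk_label : 'I_n -> M;
  lkP : is_labelled_knot lk_curve lk_label }.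

Record based_knot (n : nat) := BasedKnot {
  bk_curve : R -> M;
  bk_label : 'I_n -> M;
  bk_base : R;
  bkP : is_based_knot bk_curve bk_label bk_base }.

HB.instance Definition _ n := gen_eqMixin (singular_knot n).
HB.instance Definition _ n := gen_choiceMixin (singular_knot n).
HB.instance Definition _ n := gen_eqMixin (labelled_knot n).
HB.instance Definition _ n := gen_choiceMixin (labelled_knot n).
HB.instance Definition _ n := gen_eqMixin (based_knot n).
HB.instance Definition _ n := gen_choiceMixin (based_knot n).

Definition forget_label n (K : labelled_knot n) : singular_knot n :=
  SingularKnot (ex_intro _ (lk_label K) (lkP K)).

Lemma based_is_labelled n (K : based_knot n) :
  is_labelled_knot (bk_curve K) (bk_label K).
Proof. by case: (bkP K). Qed.

Definition forget_base n (K : based_knot n) : labelled_knot n :=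
  LabelledKnot (based_is_labelled K).

Definition smooth_family (G : R -> R -> M) : Prop :=
  smooth_map (fun z : R * R => G z.1 z.2).

Definition path01 (T : topologicalType) (f : R -> T) : Prop :=
  {within `[0, 1], continuous f}.

(* A direction-preserving rigid-vertex isotopy is a smooth path of n-singular
   knots: as the double points stay transverse all along, such a path is induced
   by an ambient isotopy carrying rigid vertices along.  Reparametrizations of
   S^1 preserving the direction are paths of this kind. *)
Definition isotopic n (K K' : singular_knot n) : Prop :=
  exists G : R -> R -> M,
  [/\ smooth_family G,
      forall s, 0 <= s <= 1 -> is_singular_knot n (G s),
      G 0 = sk_curve K & G 1 = sk_curve K'].

Definition label_isotopic n (K K' : labelled_knot n) : Prop :=
  exists (G : R -> R -> M) (P : R -> 'I_n -> M),
  [/\ smooth_family G /\ (forall j, path01 (P ^~ j)),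
      forall s, 0 <= s <= 1 -> is_labelled_knot (G s) (P s),
      G 0 = lk_curve K /\ P 0 = lk_label K &
      G 1 = lk_curve K' /\ P 1 = lk_label K'].

Definition base_isotopic n (K K' : based_knot n) : Prop :=
  exists (G : R -> R -> M) (P : R -> 'I_n -> M) (B : R -> R),
  [/\ [/\ smooth_family G, forall j, path01 (P ^~ j) & path01 B],
      forall s, 0 <= s <= 1 -> is_based_knot (G s) (P s) (B s),
      [/\ G 0 = bk_curve K, P 0 = bk_label K & B 0 = bk_base K] &
      [/\ G 1 = bk_curve K', P 1 = bk_label K' & B 1 = bk_base K']].

(* The double point [G 0 a = G 0 b = x] of [G 0] is opened by the family [G], the
   branch through [a] moving off the branch through [b] with relative velocity
   [w]; the sign of det(c'(a), c'(b), w) in an oriented chart is invariant under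
   exchanging [a] and [b] and under changing the chart.  It is positive exactly
   when the crossing that appears is positive (right-handed). *)
Definition opens_double_point (eps : bool) (G : R -> R -> M) (x : M) : Prop :=
  exists (a b : R) (i : atlas_index M),
  [/\ ~ same_param a b, G 0 a = x, G 0 b = x, chart_dom i x &
      let w := velocity i (G ^~ a) 0 - velocity i (G ^~ b) 0 in
      let d := \det (col_mx (velocity i (G 0) a)
                 (col_mx (velocity i (G 0) b) w) : 'M[R]_3) in
      if eps then 0 < d else d < 0].

(* [K'] is a positive ([eps = true]) or negative ([eps = false]) resolution of
   [K] at the [i]-th double point: the end of a family starting at [K] which opens
   that double point with the given sign, keeps all the others, and stays
   in the n-singular knots from then on.  The labels of the remaining double
   points are the induced ones. *)
Definition label_resolves (eps : bool) n (i : 'I_n.+1)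
    (K : labelled_knot n.+1) (K' : labelled_knot n) : Prop :=
  exists (G : R -> R -> M) (P : R -> 'I_n -> M),
  [/\ smooth_family G /\ (forall j, path01 (P ^~ j)),
      forall s, 0 < s <= 1 -> is_labelled_knot (G s) (P s),
      opens_double_point eps G (lk_label K i),
      G 0 = lk_curve K /\ P 0 = lk_label K \o lift i &
      G 1 = lk_curve K' /\ P 1 = lk_label K'].

Definition base_resolves (eps : bool) n (i : 'I_n.+1)
    (K : based_knot n.+1) (K' : based_knot n) : Prop :=
  exists (G : R -> R -> M) (P : R -> 'I_n -> M) (B : R -> R),
  [/\ [/\ smooth_family G, forall j, path01 (P ^~ j) & path01 B],
      forall s, 0 < s <= 1 -> is_based_knot (G s) (P s) (B s),
      opens_double_point eps G (bk_label K i),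
      [/\ G 0 = bk_curve K, P 0 = bk_label K \o lift i & B 0 = bk_base K] &
      [/\ G 1 = bk_curve K', P 1 = bk_label K' & B 1 = bk_base K']].

End SingularKnots.

(* The three isotopy relations are equivalence relations; taking the generated
   equivalence only spares reparametrizing and concatenating families here. *)
Section Classes.
Variables (T : choiceType) (r : T -> T -> Prop).

Definition generated_equiv : rel T :=
  fun x y => `[< clos_refl_sym_trans T r x y >].

Lemma generated_equiv_refl : reflexive generated_equiv.
Proof. by move=> x; apply/asboolP; apply: rst_refl. Qed.

Lemma generated_equiv_sym : symmetric generated_equiv.
Proof. by move=> x y; apply/asboolP/asboolP; apply: rst_sym. Qed.

Lemma generated_equiv_trans : transitive generated_equiv.
Proof.
move=> y x z /asboolP xy /asboolP yz; apply/asboolP.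
exact: rst_trans xy yz.
Qed.

Canonical generated_equivRel := EquivRel generated_equiv
  generated_equiv_refl generated_equiv_sym generated_equiv_trans.

Definition classes := {eq_quot generated_equiv}.
HB.instance Definition _ := Choice.on classes.

Definition class_of (x : T) : classes := \pi_classes x.
Definition representative (k : classes) : T := repr k.

End Classes.

Section KnotComplexes.
Variables (R : realType) (M : oriented3manifold R).

Definition X (n : nat) : choiceType := classes (@isotopic R M n).
Definition X_0 (n : nat) : choiceType := classes (@label_isotopic R M n).
Definition X_b (n : nat) : choiceType := classes (@base_isotopic R M n).

Definition X_0_forget n (k : X_0 n) : X n :=
  class_of _ (forget_label (representative k)).
Definition X_b_forget n (k : X_b n) : X n :=
  class_of _ (forget_label (forget_base (representative k))).

Definition X_0_resolves eps n (i : 'I_n.+1) (k : X_0 n.+1) (k' : X_0 n) : Prop :=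
  exists K K', [/\ k = class_of _ K, k' = class_of _ K' &
    label_resolves eps i K K'].
Definition X_b_resolves eps n (i : 'I_n.+1) (k : X_b n.+1) (k' : X_b n) : Prop :=
  exists K K', [/\ k = class_of _ K, k' = class_of _ K' &
    base_resolves eps i K K'].

(* The combinatorial data of the cubical complex: its n-cubes, and the relation
   "k' is the positive (negative) resolution of k at the i-th double point", that
   is, k' is the front (back) i-th face of k. *)
Record knot_complex := KnotComplex {
  cell : nat -> choiceType;
  cell_resolves : bool -> forall n, 'I_n.+1 -> cell n.+1 -> cell n -> Prop;
  cell_forget : forall n, cell n -> X n }.

Definition CK_0 : knot_complex :=
  KnotComplex X_0_resolves X_0_forget.
Definition CK_b : knot_complex :=
  KnotComplex X_b_resolves X_b_forget.

End KnotComplexes.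

Section Chains.
Variables (R : realType) (M : oriented3manifold R) (CK : knot_complex M).

Definition chains (n : nat) : lmodType rat := {freeg (cell CK n) / rat}.

Definition basis_chain n (k : cell CK n) : chains n := [freeg [:: (1 : rat, k)]].

(* The resolution is unique up to isotopy; 0 is a default value for the
   impossible case where there is none. *)
Definition resolution (eps : bool) n (i : 'I_n.+1) (k : cell CK n.+1) : chains n :=
  match pselect (exists k', cell_resolves eps i k k') with
  | left ex => basis_chain (projT1 (cid ex))
  | right _ => 0
  end.

Definition dface n (i : 'I_n.+1) (k : cell CK n.+1) : chains n :=
  resolution true i k - resolution false i k.

(* Indices start at 0, so that (-1)^(i+1) becomes (-1)^i. *)
Definition boundary n : chains n.+1 -> chains n :=
  fglift (fun k : cell CK n.+1 => \sum_(i < n.+1) (-1) ^+ i *: dface i k).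

Definition degenerate n : cell CK n -> Prop :=
  match n with
  | 0 => fun=> False
  | m.+1 => fun k => exists i : 'I_m.+1, dface i k = 0
  end.

Definition degenerate_chains n : set (chains n) :=
  [set c | exists s : seq (rat * cell CK n),
    (forall ak, ak \in s -> degenerate ak.2) /\
    c = \sum_(ak <- s) ak.1 *: basis_chain ak.2].

(* Elements of Hom(C_n / C_n(D), Q). *)
Definition relative_cochain n (f : chains n -> rat) : Prop :=
  linear (f : chains n -> rat^o) /\
  forall c, degenerate_chains c -> f c = 0.

Definition coboundary n (f : chains n -> rat) : chains n.+1 -> rat :=
  f \o @boundary n.

Definition is_cocycle n (f : chains n -> rat) : Prop :=
  relative_cochain f /\ forall c, coboundary f c = 0.

Definition is_coboundary n : (chains n -> rat) -> Prop :=
  match n with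
  | 0 => fun f => forall c, f c = 0
  | m.+1 => fun f => exists g : chains m -> rat,
      relative_cochain g /\ forall c, f c = coboundary g c
  end.

(* [f] represents a nonzero element of H^n(CK, D). *)
Definition nontrivial_class n (f : chains n -> rat) : Prop :=
  is_cocycle f /\ ~ is_coboundary f.

End Chains.

Section Vassiliev.
Variables (R : realType) (M : oriented3manifold R).

(* The skein relation is required at every double point, for one (equivalently,
   any) labelling of the double points of the singular knot. *)
Definition vassiliev_extension (phi : X M 0 -> rat)
    (psi : forall n, X M n -> rat) : Prop :=
  (forall k, psi 0 k = phi k) /\
  forall n (i : 'I_n.+1) (k : X_0 M n.+1) (kp km : X_0 M n),
    X_0_resolves true i k kp -> X_0_resolves false i k km ->
    psi n.+1 (X_0_forget k) = psi n (X_0_forget kp) - psi n (X_0_forget km).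

(* An integer index, so that V_(-1) makes sense: it is the zero space, of the
   invariants vanishing on all 0-singular knots. *)
Definition vassiliev (N : int) (phi : X M 0 -> rat) : Prop :=
  exists psi, vassiliev_extension phi psi /\
    forall n : nat, n%:Z = N + 1 -> forall k : X M n, psi n k = 0.

Definition restrict_cochain (CK : knot_complex M)
    (psi : forall n, X M n -> rat) (n : nat) : chains CK n -> rat :=
  fglift (fun k : cell CK n => psi n (cell_forget k) : rat^o).

End Vassiliev.
Arguments restrict_cochain {R M} CK psi n.

(* Main.v *)
(* Write phi_n for the cochain phi|C_n.  The skein relation turns every term of
   the boundary of an (n+1)-cube into the value of phi on the cube itself, so
   delta phi_n is phi_{n+1} times the alternating sum of n+1 ones: it is phi_{n+1}
   for n even and 0 for n odd.  Hence phi_n is a coboundary for n odd, while for n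
   even it is a cocycle only if phi has order at most n; and phi_n = 0 unless the
   order is at least n.

   This needs every double point to have a resolution of each sign.  In a chart
   one branch is pushed along a vector w transverse to both branches by a small
   periodic bump.  Measured along w, nothing else changes: the coordinates in the
   plane of the two velocities are those of the original curve, and they separate
   the two branches away from the double point; the rest of the curve is compact
   and stays at a positive distance. *)
From HB Require Import structures.
From mathcomp.multinomials Require Import freeg.
Require Import Defs.
From mathcomp Require Import all_boot all_order all_algebra generic_quotient.
From mathcomp Require Import all_classical all_reals all_analysis.
From mathcomp Require Import ring lra.
From Stdlib Require Import Relation_Operators.

Set Implicit Arguments.
Unset Strict Implicit.
Unset Printing Implicit Defensive.

Import Order.TTheory GRing.Theory Num.Theory.
Import numFieldNormedType.Exports.

Local Open Scope classical_set_scope.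
Local Open Scope ring_scope.

(** * Smooth functions *)

(** Existence of resolutions matters at two places. [resolution] falls back on 0 where there is
    none, which would spoil the formula for the coboundary; and [vassiliev] only provides some
    extension of [phi], which agrees with the given [phix] because each value on an (n+1)-singular
    knot is forced by two resolutions. The main obstacle is analytic. [smooth_family] asks for
    smoothness in all real [s], so the push has amplitude [sin s] times a bump: bounded by 1
    everywhere, with derivative 1 at [s = 0], and nonzero for [0 < s <= 1]. The bump must be smooth
    on R/Z, hence is built from a cosine and the function exp(-1/x). The sizes depend on each other
    in one order: a radius [D] on which the plane coordinates separate the branches, then the
    distance [r] from the double point to the rest of the curve, then the smaller radius [d] and the
    length of [w]. For based knots one more fact is needed: every singular knot admits a base point,
    as vanishing on the cells has to give vanishing on all of [X]. *)

Lemma near_eq_differentiable (R : realType) (V W : normedModType R)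
    (f g : V -> W) (x : V) :
  (\near x, f x = g x) -> differentiable f x -> differentiable g x.
Proof.
move=> fg df.
have fgx : f x = g x by exact: nbhs_singleton fg.
have [cd ed] := (diff_locallyP x f).1 df.
have eg : g \o shift x = cst (g x) + 'd f x +o_ (0 : V) id.
  apply/eqaddoP => e e0.
  move/eqaddoP : ed => /(_ e e0) ed.
  have fg0 : \forall y \near (0 : V), f (y + x) = g (y + x).
    move: fg; rewrite (near_shift (0 : V) x); apply: filterS => y /=.
    by rewrite subr0.
  near=> y.
  have -> : (g \o shift x - (cst (g x) + 'd f x)) y =
            (f \o shift x - (cst (f x) + 'd f x)) y.
    rewrite -fgx /=.
    have E : f (y + x) = g (y + x) by near: y.
    by rewrite !fctE /= E.
  by near: y.
by apply/diff_locallyP; rewrite (diff_unique cd eg).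
Unshelve. all: by end_near. Qed.

Section ClassC.
Variable R : realType.
Implicit Types V W U : normedModType R.

Lemma class_C_sub V W k (A B : set V) (f : V -> W) :
  B `<=` A -> class_C k A f -> class_C k B f.
Proof.
move=> BA; elim: k f => [|k ih] f /=; first by move=> h x /BA /h.
by case=> d h; split=> [x /BA /d//|v]; apply: ih.
Qed.

Lemma class_C_eq V W k (A : set V) (f g : V -> W) :
  open A -> (forall x, A x -> f x = g x) -> class_C k A f -> class_C k A g.
Proof.
move=> oA; elim: k f g => [|k ih] f g fg /=.
  move=> h x Ax.
  have n : \near x, f x = g x.
    by have /filterS := open_nbhs_nbhs (conj oA Ax); apply => y /fg.
  rewrite /prop_for /continuous_at -(fg x Ax).
  by apply: cvg_trans (h x Ax); apply: near_eq_cvg.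
have n x : A x -> \near x, f x = g x.
  by move=> Ax; have /filterS := open_nbhs_nbhs (conj oA Ax); apply => y /fg.
case=> d h; split=> [x Ax|v]; first exact: near_eq_differentiable (n x Ax) (d x Ax).
apply: ih (h v) => x Ax; apply: near_eq_derive; exact: n.
Qed.

Lemma class_CS V W k (A : set V) (f : V -> W) :
  class_C k.+1 A f -> class_C k A f.
Proof.
elim: k f => [|k ih] f; first by case=> d _ x /d; exact: differentiable_continuous.
by case=> d h; split=> // v; apply: ih; apply: h.
Qed.

Lemma class_C_cst V W k (A : set V) (w : W) : class_C k A (cst w : V -> W).
Proof.
elim: k w => [|k ih] w /=; first by move=> x _; exact: cvg_cst.
split=> [x _|v]; first exact: differentiable_cst.
by under eq_fun do rewrite derive_cst; apply: ih.
Qed.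

Lemma class_CD V W k (A : set V) (f g : V -> W) : open A ->
  class_C k A f -> class_C k A g -> class_C k A (fun x => f x + g x).
Proof.
move=> oA; elim: k f g => [|k ih] f g /=.
  by move=> hf hg x Ax; apply: continuousD; [apply: hf|apply: hg].
move=> [df hf] [dg hg]; split=> [x Ax|v].
  by apply: differentiableD; [exact: df|exact: dg].
apply: (class_C_eq oA _ (ih _ _ (hf v) (hg v))) => x Ax.
by rewrite deriveD //; apply: diff_derivable; [exact: df|exact: dg].
Qed.

Lemma class_C_sum V W k (A : set V) n (f : 'I_n -> V -> W) : open A ->
  (forall i, class_C k A (f i)) -> class_C k A (fun x => \sum_i f i x).
Proof.
move=> oA; elim: n f => [|n ih] f hf.
  under eq_fun do rewrite big_ord0; exact: class_C_cst.
under eq_fun do rewrite big_ord_recl; apply: class_CD => //.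
exact: ih.
Qed.

Lemma class_C_linear V W U k (A : set V) (f : V -> W) (L : {linear W -> U}) :
  open A -> continuous L -> class_C k A f -> class_C k A (L \o f).
Proof.
move=> oA cL; elim: k f => [|k ih] f /=.
  by move=> hf x Ax; apply: continuous_comp; [apply: hf|exact: cL].
move=> [df hf]; split=> [x Ax|v].
  by apply: differentiable_comp; [exact: df|exact: linear_differentiable].
apply: (class_C_eq oA _ (ih _ (hf v))) => x Ax.
have dL y : differentiable L y by exact: linear_differentiable.
rewrite (deriveE v (differentiable_comp (df x Ax) (dL _))).
by rewrite (diff_comp (df x Ax) (dL _)) /= (diff_lin _ cL) deriveE //; exact: df.
Qed.

(** For an affine inner map the direction of differentiation is the constant [L v], so the induction
    closes without coordinates on [V]. *)
Lemma class_C_precomp V W U k (A : set V) (B : set U) (L : {linear U -> V}) (c : V)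
    (g : V -> W) :
  open B -> continuous L -> (forall x, B x -> A (L x + c)) ->
  class_C k A g -> class_C k B (fun x => g (L x + c)).
Proof.
move=> oB cL BA; elim: k g => [|k ih] g /=.
  move=> hg x Bx; apply: (@continuous_comp _ _ _ (fun x => L x + c) g).
    by apply: continuousD; [exact: cL|exact: cvg_cst].
  exact: hg (BA _ Bx).
move=> [dg hg].
have dL x : is_diff x (fun x => L x + c) L.
  have h1 : is_diff x L L.
    by apply: DiffDef; [exact: linear_differentiable|exact: diff_lin].
  by apply: is_diff_eq; rewrite addr0.
split=> [x Bx|v].
  by apply: (@differentiable_comp _ _ _ _ (fun x => L x + c) g); [case: (dL x)|exact: dg (BA _ Bx)].
apply: (class_C_eq oB _ (ih _ (hg (L v)))) => x Bx.
have dc : differentiable (fun x => L x + c) x by case: (dL x).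
have dgx := dg _ (BA _ Bx).
rewrite (deriveE v (differentiable_comp (f := fun x => L x + c) (g := g) dc dgx)).
rewrite (diff_comp (f := fun x => L x + c) (g := g) dc dgx) /= deriveE //.
by congr ('d _ _ _); rewrite (diff_val (f := fun x => L x + c)).
Qed.

Lemma scale_is_bilinear W :
  bilinear_for (GRing.Scale.Law.clone _ _ *:%R _) (GRing.Scale.Law.clone _ _ *:%R _)
    (@GRing.scale R W).
Proof.
split=> [u'|u] a x y /=; first by rewrite scalerDl scalerA.
by rewrite scalerDr !scalerA mulrC.
Qed.

Lemma diff_scale V W (f : V -> R) (g : V -> W) x :
  differentiable f x -> differentiable g x ->
  is_diff x (fun y => f y *: g y) (fun v => f x *: 'd g x v + 'd f x v *: g x).
Proof.
move=> df dg.
pose B : {bilinear R -> W -> W} :=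
  HB.pack (@GRing.scale R W) (bilinear_isBilinear.Build _ _ _ _ _ _ _ (@scale_is_bilinear W)).
have cB : continuous (fun p : R * W => B p.1 p.2) by exact: scale_continuous.
have dB p := differentiable_bilin (f := B) p cB.
have dp := differentiable_pair df dg.
apply: DiffDef.
  exact: (differentiable_comp (f := fun y => (f y, g y)) (g := fun p => B p.1 p.2) dp (dB _)).
rewrite (diff_comp (f := fun y => (f y, g y)) (g := fun p => B p.1 p.2) dp (dB _)).
by rewrite (diff_bilin _ cB) (diff_pair df dg).
Qed.

Lemma class_C_scale V W k (A : set V) (f : V -> R) (g : V -> W) : open A ->
  class_C k A f -> class_C k A g -> class_C k A (fun x => f x *: g x).
Proof.
move=> oA; elim: k f g => [|k ih] f g.
  by move=> hf hg x Ax; apply: continuousZ; [exact: hf|exact: hg].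
move=> hf0 hg0; have [df hf] := hf0; have [dg hg] := hg0; split=> [x Ax|v].
  by case: (diff_scale (df x Ax) (dg x Ax)).
have f' := class_CS hf0; have g' := class_CS hg0.
apply: (class_C_eq oA _ (class_CD oA (ih _ _ f' (hg v)) (ih _ _ (hf v) g'))) => x Ax.
have h := diff_scale (df x Ax) (dg x Ax).
rewrite [RHS]deriveE; last by case: h.
by rewrite (@diff_val _ _ _ _ _ _ _ h) !deriveE //; [exact: df|exact: dg].
Qed.

(** [class_C] differentiates in fixed directions, whereas the chain rule yields the derivative of
    [g] in the direction ['D_v f x], which moves with [x]. Expanding it in a finite basis with
    continuous coordinates gives a sum of products to which induction applies. *)
Definition has_coordinates W := exists m (e : 'I_m -> W) (p : 'I_m -> {linear W -> R}),
  (forall j, continuous (p j)) /\ forall w, w = \sum_j p j w *: e j.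

Lemma class_C_comp V W U k (A : set V) (B : set W) (f : V -> W) (g : W -> U) :
  has_coordinates W -> open A -> (forall x, A x -> B (f x)) ->
  class_C k A f -> class_C k B g -> class_C k A (g \o f).
Proof.
move=> [m [e [p [cp pE]]]] oA AB; elim: k g f AB => [|k ih] g f AB.
  by move=> hf hg x Ax; apply: continuous_comp; [exact: hf|exact: hg (AB _ Ax)].
move=> hf0 hg0; have [df hf] := hf0; have [dg hg] := hg0; split=> [x Ax|v].
  by apply: differentiable_comp; [exact: df|exact: dg (AB _ Ax)].
have f' := class_CS hf0.
have key : class_C k A (fun x => \sum_j p j ('D_v f x) *: ('D_(e j) g \o f) x).
  apply: class_C_sum => // j; apply: class_C_scale => //.
    exact: (class_C_linear (L := p j) oA (cp j) (hf v)).
  exact: (ih _ _ AB f' (hg (e j))).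
apply: (class_C_eq oA _ key) => x Ax.
have dfx := df x Ax; have dgx := dg _ (AB _ Ax).
rewrite [RHS]deriveE; last exact: differentiable_comp.
rewrite (diff_comp dfx dgx) /= -(deriveE v dfx).
rewrite [X in _ = 'd g (f x) X](pE ('D_v f x)) linear_sum.
by apply: eq_bigr => j _; rewrite linearZ /= (deriveE (e j) dgx).
Qed.

Lemma has_coordinates_scalar : has_coordinates R.
Proof.
exists 1%N, (fun=> 1), (fun=> (idfun : {linear R -> R})); split=> [j x|w]; first exact: cvg_id.
by rewrite big_ord1 /= [_%:A]mulr1.
Qed.

Definition coordinate n (j : 'I_n) (w : 'rV[R]_n) : R := w 0 j.

Lemma coordinate_is_linear n (j : 'I_n) : linear (coordinate j).
Proof. by move=> a u v; rewrite /coordinate !mxE. Qed.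

HB.instance Definition _ n (j : 'I_n) :=
  GRing.isLinear.Build R 'rV[R]_n R _ (coordinate j) (coordinate_is_linear j).

Lemma has_coordinates_rV n : has_coordinates 'rV[R]_n.+1.
Proof.
exists n.+1, (fun j => delta_mx 0 j), (fun j => @coordinate n.+1 j).
by split=> [j|w]; [exact: coord_continuous|exact: row_sum_delta].
Qed.
End ClassC.

(** * Trigonometric functions, flat functions and periodic bumps *)

Section SmoothFunctions.
Variable R : realType.

(** Induction on the order of differentiability needs the claim for the derivatives too, hence a
    family closed under them; the factor [v] accounts for ['D_v]. *)
Lemma class_Coo_stable_family (F : set (R -> R)) (f : R -> R) :
  (forall g, F g -> (forall x, derivable g x 1) /\
     forall v, F (fun x => v * 'D_1 g x)) ->
  F f -> class_Coo setT f.
Proof.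
move=> hF Ff k; elim: k f Ff => [|k ih] f Ff.
  by move=> x _; apply: differentiable_continuous; apply/derivable1_diffP; apply (hF f Ff).
have [df hv] := hF f Ff; split=> [x _|v]; first exact/derivable1_diffP.
have -> : 'D_v f = fun x => v * 'D_1 f x; last exact: ih.
apply/funext => x; have dx : differentiable f x by exact/derivable1_diffP.
by rewrite !deriveE // -[X in 'd f x X = _](mulr1 v) -[v * 1]/(v *: 1) linearZ.
Qed.

Lemma class_Coo_trig (b c : R) : class_Coo setT (fun x : R => b * sin x + c * cos x).
Proof.
pose F := [set f | exists b c : R, f = fun x => b * sin x + c * cos x].
apply: (@class_Coo_stable_family F); last by exists b, c.
move=> _ [{}b [{}c ->]].
have h (x : R) : is_derive x (1 : R) (fun x : R => b * sin x + c * cos x) (b * cos x - c * sin x).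
  have hs := is_deriveZ b (is_derive_sin x); have hc := is_deriveZ c (is_derive_cos x).
  by apply: is_derive_eq (is_deriveD hs hc) _; rewrite scalerN.
split=> [x|v]; first by case: (h x).
exists (- (v * c)), (v * b); apply/funext => x.
rewrite (derive_val (is_derive := h x)); ring.
Qed.

Definition flat (P : {poly R}) (x : R) : R :=
  if 0 < x then P.[x^-1] * expR (- x^-1) else 0.

Lemma exprn_le_expR (y : R) i : 0 <= y -> y ^+ i <= i`!%:R * expR y.
Proof.
move=> y0; case: i => [|i].
  by rewrite expr0 fact0 mul1r -[leLHS]addr0 (le_trans _ (expR_ge1Dx y)) // lerD2l.
have f0 : 0 < (i.+1)`!%:R :> R by rewrite ltr0n fact_gt0.
rewrite mulrC -ler_pdivrMr //; apply: le_trans (expR_ge1Dxn i y0).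
by rewrite lerDr ler01.
Qed.

Lemma poly_expR_bounded (P : {poly R}) :
  exists2 C, 0 <= C & forall y, 0 <= y -> `|P.[y]| * expR (- y) <= C.
Proof.
exists (\sum_(i < size P) `|P`_i| * i`!%:R).
  by apply: sumr_ge0 => i _; rewrite mulr_ge0.
move=> y y0; rewrite expRN ler_pdivrMr ?expR_gt0 // horner_coef.
apply: le_trans (ler_norm_sum _ _ _) _; rewrite mulr_suml; apply: ler_sum => i _.
rewrite normrM -mulrA ler_wpM2l // normrX (ger0_norm y0); exact: exprn_le_expR.
Qed.

Lemma is_derive_flat (P : {poly R}) (x : R) :
  is_derive x (1 : R) (flat P) (flat ('X^2 * (P - P^`())) x).
Proof.
have [x0|x0|->] := ltgtP x 0.
- rewrite /flat ltNge (ltW x0) /=.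
  have n : \near x, cst 0 x = flat P x.
    near=> y; rewrite /flat ltNge.
    suff -> : y <= 0 by [].
    by rewrite ltW //; near: y; exact: lt_nbhsl.
  exact: near_eq_is_derive n (is_derive_cst _ _ _).
- pose g (y : R) : R := P.[y^-1] * expR (- y^-1).
  have n : \near x, g x = flat P x.
    near=> y; rewrite /flat.
    suff -> : 0 < y by [].
    near: y; exact: lt_nbhsr.
  apply: near_eq_is_derive n _.
  have xn : x != 0 by rewrite gt_eqF.
  have hV : is_derive x (1 : R) (fun y : R => y^-1) (- x ^- 2).
    by apply: is_derive_eq (is_deriveV xn (is_derive_id x (1 : R))) _; rewrite [_ *: _]mulr1.
  have hP := @is_derive1_comp R (horner P) (fun y => y^-1) x _ _ (is_derive_poly P _) hV.
  have hE := @is_derive1_comp R expR (fun y => - y^-1) x _ _ (is_derive_expR _) (is_deriveN hV).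
  apply: is_derive_eq (is_deriveM hP hE) _.
  rewrite /flat x0 /= !hornerE /= /GRing.scale /= exprVn; ring.
- rewrite /flat ltxx.
  (* With y = 1/h the difference quotient at 0 is y P(y) exp(-y). Bounding y^2 P(y) exp(-y) instead
     leaves a factor h, which tends to 0. *)
  have [C C0 hC] := poly_expR_bounded ('X^2 * P).
  have C1 : 0 < C + 1 by rewrite ltr_wpDl.
  have key : h^-1 *: ((flat P \o shift 0) (h *: 1) - flat P 0) @[h --> 0^'] --> (0 : R).
    apply/cvgrPdist_le => e e0; near=> h.
    rewrite /= addr0 /flat ltxx subr0 sub0r normrN [h%:A]mulr1.
    case: ifPn => h0; last by rewrite scaler0 normr0 ltW.
    have y0 : 0 <= h^-1 by rewrite invr_ge0 ltW.
    have := hC _ y0; rewrite !hornerE /= normrM.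
    rewrite (ger0_norm (exprn_ge0 2 y0)) [_ *: _]mulrA !normrM (ger0_norm y0).
    rewrite (ger0_norm (expR_ge0 _)) => b.
    have -> : h^-1 * `|P.[h^-1]| * expR (- h^-1) =
       h * (h^-1 ^+ 2 * `|P.[h^-1]| * expR (- h^-1)).
      by rewrite expr2 !mulrA mulfV ?gt_eqF // mul1r.
    apply: (le_trans (ler_wpM2l (ltW h0) b)).
    have hle : h <= e / (C + 1).
      rewrite ltW // (le_lt_trans (ler_norm h)) //.
      by near: h; apply: dnbhs0_lt; rewrite divr_gt0.
    apply: (le_trans (ler_wpM2r C0 hle)).
    rewrite -mulrA ger_pMr // mulrC ler_pdivrMr // mul1r lerDl; exact: ler01.
  by apply: DeriveDef; [apply/cvg_ex; exists 0|exact/cvg_lim].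
Unshelve. all: by end_near. Qed.

Lemma class_Coo_flat (P : {poly R}) : class_Coo setT (flat P).
Proof.
apply: (@class_Coo_stable_family [set f | exists P, f = flat P]); last by exists P.
move=> _ [Q ->]; split=> [x|v]; first by case: (is_derive_flat Q x).
exists (v *: ('X^2 * (Q - Q^`()))); apply/funext => x.
rewrite (derive_val (is_derive := is_derive_flat Q x)) /flat.
by case: ifP => _; rewrite ?mulr0 // hornerZ mulrA.
Qed.

Lemma periodic_int (T : Type) (f : R -> T) : (forall t, f (t + 1) = f t) ->
  forall t (z : int), f (t + z%:~R) = f t.
Proof.
move=> hf.
have hn t (n : nat) : f (t + n%:R) = f t.
  by elim: n => [|n ih]; rewrite ?addr0 // -natr1 addrA hf.
move=> t [n|n]; first exact: hn.
by rewrite NegzE mulrNz -(hn _ n.+1) subrK.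
Qed.

(** [flat 1] is applied to cos(2 pi (t - a)) - cos(2 pi e): periodicity comes from the cosine, and
    positivity means that [t] is closer than [e] to [a] modulo integers. *)
Lemma periodic_bump (a d : R) : 0 < d -> exists rho : R -> R,
  [/\ class_Coo setT rho, forall t, rho (t + 1) = rho t, 0 < rho a,
      forall t, 0 <= rho t <= 1 &
      forall t, rho t != 0 -> exists z : int, `|t - z%:~R - a| < d].
Proof.
move=> d0.
(* The bound 1/2 keeps 2 pi e within [0, pi], where the cosine decreases. *)
pose e := Num.min d (2^-1).
have e0 : 0 < e by rewrite lt_min d0 /= invr_gt0.
have ed : e <= d by rewrite ge_min lexx.
have e2 : e <= 2^-1 by rewrite ge_min lexx orbT.
have pi0 : 0 < pi :> R by exact: pi_gt0.
pose th (t : R) : R := 2 * pi * t - 2 * pi * a.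
pose k : R := cos (2 * pi * e).
have k1 : k < 1.
  rewrite -(cos0 R) ltr_cos ?in_itv /= ?lexx ?(ltW pi0) //.
    by rewrite !mulr_gt0.
  rewrite !mulr_ge0 ?(ltW pi0) ?(ltW e0) //= -mulrA mulrCA ger_pMr //.
  by rewrite -ler_pdivlMl ?mulr1.
pose rho t := flat 1 (cos (th t) - k); exists rho; split.
- move=> n.
  have h1 : class_C n setT (fun t : R => cos (th t)).
    have -> : (fun t => cos (th t)) = fun t => (fun x : R => 0 * sin x + 1 * cos x)
       ((2 * pi) *: t + - (2 * pi * a)).
      by apply/funext => t; rewrite mul0r add0r mul1r.
    apply: (@class_C_precomp _ _ _ _ n setT setT ( *:%R (2 * pi)) _
      (fun x : R => 0 * sin x + 1 * cos x) openT _ _ (class_Coo_trig 0 1 n)) => //.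
    exact: scaler_continuous.
  have h2 : class_C n setT (fun t : R => cos (th t) - k).
    exact: (class_CD openT h1 (class_C_cst _ _ (- k))).
  exact: (class_C_comp (has_coordinates_scalar R) openT _ h2 (class_Coo_flat 1 n)).
- move=> t; rewrite /rho; congr (flat 1 (_ - k)).
  by rewrite /th mulrDr mulr1 addrAC -[RHS]cosD2pi mulr_natl.
- rewrite /rho /th subrr cos0 /flat subr_gt0 k1 hornerC mul1r; exact: expR_gt0.
- move=> t; rewrite /rho /flat; case: ifPn => [x0|_]; last by rewrite lexx ler01.
  rewrite hornerC mul1r expR_ge0 /= -expR0 ler_expR oppr_le0 invr_ge0; exact: ltW.
- move=> t; rewrite /rho /flat; case: ifPn => [x0 _|]; last by rewrite eqxx.
  (* An integer nearest to [t - a], so that the remainder [u] has absolute value at most 1/2. *)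
  exists (Num.floor (t - a + 2^-1)); set z := Num.floor _.
  have /andP[z1 z2] : z%:~R <= t - a + 2^-1 < z%:~R + 1.
    by rewrite floor_le /= -intrD1 floorD1_gt.
  set u := t - z%:~R - a.
  have uh : `|u| <= 2^-1 by rewrite ler_norml /u; lra.
  have cu : cos (th t) = cos (2 * pi * `|u|).
    have -> : 2 * pi * `|u| = `|2 * pi * u|.
      by rewrite normrM (ger0_norm (x := 2 * pi)) // mulr_ge0 ?(ltW pi0).
    rewrite cos_norm.
    have hp : forall t, cos (th (t + 1)) = cos (th t).
      move=> t'; rewrite /th mulrDr mulr1 addrAC.
      by rewrite -[RHS]cosD2pi mulr_natl.
    rewrite -(periodic_int hp t (- z)) mulrNz /th; congr cos.
    by rewrite /u !mulrBr.
  rewrite (lt_le_trans _ ed) // -(ltr_pM2l (x := 2 * pi)) ?mulr_gt0 //.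
  move: x0; rewrite subr_gt0 cu ltr_cos // in_itv /=.
    rewrite !mulr_ge0 ?(ltW pi0) //= -mulrA mulrCA ger_pMr //.
    by rewrite -ler_pdivlMl ?mulr1.
  rewrite !mulr_ge0 ?(ltW pi0) ?(ltW e0) //= -mulrA mulrCA ger_pMr //.
  by rewrite -ler_pdivlMl ?mulr1.
Qed.
End SmoothFunctions.

(** * Smooth maps into a manifold *)

Section SmoothMaps.
Variables (R : realType) (M : oriented3manifold R).

Lemma class_C_local (V W : normedModType R) k (A : set V) (f : V -> W) :
  (forall x, A x -> exists U, [/\ open U, U x & class_C k U f]) -> class_C k A f.
Proof.
elim: k f => [|k ih] f h /=; first by move=> x /h [U [_ Ux]]; apply.
split=> [x /h [U [_ Ux]] [d _]|v]; first exact: d.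
by apply: ih => x /h [U [oU Ux [_ hv]]]; exists U; split=> //; exact: hv.
Qed.

Lemma smooth_map_continuous (V : normedModType R) (f : V -> M) :
  smooth_map f -> continuous f.
Proof.
move=> sf z; have [i [U [oU Uz fU cf]]] := sf z.
have fz : chart_dom i (f z) by apply: fU; exists z.
have n : \near z, (chart_inv i \o (chart i \o f)) z = f z.
  have /filterS := open_nbhs_nbhs (conj oU Uz); apply => y Uy /=.
  by rewrite chart_invK //; apply: fU; exists y.
have key : {for z, continuous (chart_inv i \o (chart i \o f))}.
  apply: continuous_comp; first exact: (cf 0%N).
  by apply: chart_inv_continuous; exists (f z).
rewrite /continuous_at -(nbhs_singleton n).
by apply: cvg_trans key; apply: near_eq_cvg.
Qed.

(** [smooth_map] only offers some chart at each point; composing with a smooth transition map passes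
    to the chart [i]. *)
Lemma smooth_map_chart (V : normedModType R) (f : V -> M) i :
  smooth_map f -> class_Coo (f @^-1` chart_dom i) (chart i \o f).
Proof.
move=> sf k; apply: class_C_local => z fz.
have [j [U [oU Uz fU cf]]] := sf z.
have cont := smooth_map_continuous sf.
have oUi : open (U `&` f @^-1` chart_dom i).
  apply: openI => //; apply: open_comp => [y _|]; first exact: cont.
  exact: chart_dom_open.
exists (U `&` f @^-1` chart_dom i); split=> //.
have sub : U `&` f @^-1` chart_dom i `<=` U by move=> y [].
have key : class_C k (U `&` f @^-1` chart_dom i)
    ((chart i \o chart_inv j) \o (chart j \o f)).
  apply: (class_C_comp (has_coordinates_rV R 2) oUi _ (class_C_sub sub (cf k))
    (transition_smooth j i k)) => y [Uy fy].
  by exists (f y) => //; split=> //; apply: fU; exists y.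
apply: class_C_eq oUi _ key => y [Uy fy] /=.
by rewrite chart_invK //; apply: fU; exists y.
Qed.

Lemma open_preimage_chart (V : normedModType R) (f : V -> M) i :
  smooth_map f -> open (f @^-1` chart_dom i).
Proof.
move=> sf; apply: open_comp => [y _|]; last exact: chart_dom_open.
exact: smooth_map_continuous.
Qed.

Lemma chartK i y : (chart i @` chart_dom i) y -> chart i (@chart_inv _ M i y) = y.
Proof. by move=> [x dx <-]; rewrite chart_invK. Qed.

Lemma velocity_change i j (c : R -> M) t : smooth_map c ->
  chart_dom i (c t) -> chart_dom j (c t) ->
  velocity j c t = velocity i c t *m 'J (chart j \o chart_inv i) (chart i (c t)).
Proof.
move=> sc di dj; rewrite /velocity.
have oU := openI (open_preimage_chart i sc) (open_preimage_chart j sc).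
have n : \near t, (chart j \o c) t = ((chart j \o chart_inv i) \o (chart i \o c)) t.
  have /filterS := open_nbhs_nbhs (conj oU (conj di dj)); apply => u [du _] /=.
  by rewrite chart_invK.
rewrite (near_eq_derive _ n).
have df : differentiable (chart i \o c) t by have [d _] := smooth_map_chart i sc 1; apply: d.
have dg : differentiable (chart j \o chart_inv i) ((chart i \o c) t).
  by have [d _] := transition_smooth (o := M) i j 1; apply: d; exists (c t).
rewrite deriveE; last exact: differentiable_comp.
by rewrite (diff_comp df dg) /= -(deriveE _ df) -(deriveE _ dg) deriveEjacobian.
Qed.

(** The Jacobian of a transition has positive determinant, hence is invertible. An immersion can
    thus be checked in one chart per point. *)
Lemma velocity_neq0_change i j (c : R -> M) t : smooth_map c ->
  chart_dom i (c t) -> chart_dom j (c t) -> velocity i c t != 0 -> velocity j c t != 0.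
Proof.
move=> sc di dj; apply: contra => /eqP; rewrite (velocity_change sc di dj) => h.
have u : 'J (chart j \o chart_inv i) (chart i (c t)) \in unitmx.
  rewrite unitmxE unitfE gt_eqF //; exact: transition_oriented.
by rewrite -(mulmxK u (velocity i c t)) h mul0mx.
Qed.

Lemma velocity_periodic i (c : R -> M) t (z : int) : closed_curve c ->
  velocity i c (t + z%:~R) = velocity i c t.
Proof.
move=> cc; have pc := periodic_int cc.
have sh : (chart i \o c) \o shift (t + z%:~R) = (chart i \o c) \o shift t.
  by apply/funext => h /=; rewrite addrA pc.
by rewrite /velocity /derive sh /= pc.
Qed.

Lemma velocity_near i (c c' : R -> M) t : (\near t, c t = c' t) ->
  velocity i c t = velocity i c' t.
Proof.
by move=> n; apply: near_eq_derive; apply: filterS n => u /= ->.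
Qed.

Lemma linear_velocity i (c : R -> M) t (l : {linear 'rV[R]_3 -> R}) : continuous l ->
  smooth_map c -> chart_dom i (c t) -> l (velocity i c t) = 'D_1 (l \o (chart i \o c)) t.
Proof.
move=> lc sc dc.
have dl y : differentiable l y by exact: linear_differentiable.
have df : differentiable (chart i \o c) t.
  by have [df _] := smooth_map_chart i sc 1; apply: df.
rewrite deriveE; last exact: differentiable_comp.
by rewrite (diff_comp df (dl _)) /= (diff_lin _ lc) /velocity deriveE.
Qed.

Lemma same_param_sym (t u : R) : same_param t u -> same_param u t.
Proof. by move=> [z ->]; exists (- z); rewrite mulrNz addrK. Qed.

Lemma same_param_trans (t u v : R) : same_param t u -> same_param u v -> same_param t v.
Proof. by move=> [z ->] [z' ->]; exists (z + z'); rewrite mulrzDr addrA. Qed.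

Lemma same_param_near (t u : R) : `|u - t| < 1 -> same_param t u -> u = t.
Proof.
move=> h [z uE]; move: h; rewrite uE addrAC subrr add0r -intr_norm -[1]/(1%:~R) ltr_int.
rewrite -[1]add0r ltzD1 normr_le0 => /eqP ->; exact: addr0.
Qed.

End SmoothMaps.

(** * Transverse branches in a chart *)

Section Estimates.
Variable R : realType.

Lemma mean_value_ball (f : R -> R) (a d x y : R) :
  (forall t, `|t - a| < d -> derivable f t 1) ->
  `|x - a| < d -> `|y - a| < d ->
  exists2 z, `|z - a| < d & f x - f y = 'D_1 f z * (x - y).
Proof.
move=> df; wlog xy : x y / y <= x.
  move=> h hx hy; have [/h|/ltW /h hh] := leP y x; first exact.
  by have [z hz e] := hh hy hx; exists z => //; rewrite -opprB e -mulrN opprB.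
rewrite !ltr_norml => hx hy.
have inb z : y <= z <= x -> `|z - a| < d by rewrite ltr_norml; lra.
have [||z] := @MVT_segment R f ('D_1 f) y x xy.
- by move=> z; rewrite in_itv /= => /andP[z1 z2]; apply/derivableP/df/inb; rewrite !ltW.
- apply: derivable_within_continuous => z; rewrite in_itv /= => hz; exact/df/inb.
- by rewrite in_itv /= => hz e; exists z; first exact: inb.
Qed.

(* [f] and [g] are the coordinates of one plane curve, whose velocity is close to
   (1, 0) near [a] and to (0, 1) near [b]. *)
Lemma transverse_isolated (f g : R -> R) (a b d : R) :
  (forall t, `|t - a| < d -> [/\ derivable f t 1, derivable g t 1,
     2^-1 < 'D_1 f t & `|'D_1 g t| < 2^-1]) ->
  (forall t, `|t - b| < d -> [/\ derivable f t 1, derivable g t 1,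
     `|'D_1 f t| < 2^-1 & 2^-1 < 'D_1 g t]) ->
  f a = f b -> g a = g b ->
  forall t u, `|t - a| < d -> `|u - b| < d -> f t = f u -> g t = g u ->
  t = a /\ u = b.
Proof.
move=> ha hb fab gab t u ta ub ftu gtu.
have d0 : 0 < d by apply: le_lt_trans ta.
have aa : `|a - a| < d by rewrite subrr normr0.
have bb : `|b - b| < d by rewrite subrr normr0.
have [z1 h1 e1] := mean_value_ball (fun t h => let: And4 h _ _ _ := ha t h in h) ta aa.
have [z2 h2 e2] := mean_value_ball (fun t h => let: And4 _ h _ _ := ha t h in h) ta aa.
have [z3 h3 e3] := mean_value_ball (fun t h => let: And4 h _ _ _ := hb t h in h) ub bb.
have [z4 h4 e4] := mean_value_ball (fun t h => let: And4 _ h _ _ := hb t h in h) ub bb.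
have [_ _ p1 _] := ha _ h1; have [_ _ _ p2] := ha _ h2.
have [_ _ p3 _] := hb _ h3; have [_ _ _ p4] := hb _ h4.
have E1 : 'D_1 f z1 * (t - a) = 'D_1 f z3 * (u - b) by rewrite -e1 -e3 ftu fab.
have E2 : 'D_1 g z2 * (t - a) = 'D_1 g z4 * (u - b) by rewrite -e2 -e4 gtu gab.
move: e1 e2 e3 e4 => _ _ _ _.
move: ('D_1 f z1) ('D_1 g z2) ('D_1 f z3) ('D_1 g z4) E1 E2 p1 p2 p3 p4.
move=> A1 A2 A3 A4 E1 E2 p1 p2 p3 p4.
have f1 : A1 * `|t - a| = `|A3| * `|u - b|.
  by rewrite -normrM -E1 normrM (ger0_norm (x := A1)) //; lra.
have f2 : `|A2| * `|t - a| = A4 * `|u - b|.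
  by rewrite -normrM E2 normrM (ger0_norm (x := A4)) //; lra.
have := normr_ge0 (t - a); have := normr_ge0 (u - b); have := normr_ge0 A2; have := normr_ge0 A3.
move: {E1 E2} f1 f2 p2 p3.
suff fin (x y r s : R) : A1 * x = s * y -> r * x = A4 * y -> r < 2^-1 -> s < 2^-1 ->
    0 <= s -> 0 <= r -> 0 <= y -> 0 <= x -> x = 0 /\ y = 0.
  move=> f1 f2 p2 p3 n1 n2 n3 n4; have [/normr0P + /normr0P +] := fin _ _ _ _ f1 f2 p2 p3 n1 n2 n3 n4.
  by rewrite !subr_eq0 => /eqP -> /eqP ->.
move=> k1 k2 hr hs s0 r0 y0 x0.
have xy : x <= y by nra.
have yx : y <= x by nra.
have exy : x = y by apply/le_anti/andP.
subst y; have x0' : x = 0 by nra.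
by [].
Qed.

Lemma near_interval (P : R -> Prop) (a : R) : (\forall t \near a, P t) ->
  exists2 d, 0 < d & forall t, `|t - a| < d -> P t.
Proof.
move=> /nbhs_ballP [d /= d0 h]; exists d => // t ht; apply: h.
by rewrite /ball /= distrC.
Qed.

End Estimates.

(** * Frames of three-space and their dual coordinates *)

Section Frames.
Variable F : realFieldType.
Implicit Types u v w : 'rV[F]_3.

Definition frame_mx u v w : 'M[F]_3 := col_mx u (col_mx v w).

Lemma frame_mx_scale u v w k : \det (frame_mx u v (k *: w)) = k * \det (frame_mx u v w).
Proof.
pose D : 'M[F]_(1 + (1 + 1)) := block_mx 1%:M 0 0 (block_mx 1%:M 0 0 k%:M : 'M[F]_(1 + 1)).
have E : col_mx u (col_mx v (k *: w)) = D *m col_mx u (col_mx v w).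
  by rewrite /D !mul_block_col !mul0mx !mul1mx mul_scalar_mx ?addr0 ?add0r.
have -> : frame_mx u v (k *: w) = (D : 'M[F]_3) *m frame_mx u v w by exact: E.
rewrite det_mulmx; congr (_ * _).
transitivity (\det D) => //.
by rewrite /D !det_ublock !det1 !mul1r det_scalar1.
Qed.

(** Two rows have rank at most 2, so some [w] lies outside their span; replacing [w] by its opposite
    corrects the sign of the determinant. *)
Lemma frame_mx_complete u v (pos : bool) : row_free (col_mx u v) ->
  exists w, if pos then 0 < \det (frame_mx u v w) else \det (frame_mx u v w) < 0.
Proof.
move=> fr.
have [w hw] : exists w, ~~ (w <= col_mx u v)%MS.
  apply/not_existsP => h.
  have : ((1%:M : 'M[F]_3) <= col_mx u v)%MS.
    by apply/row_subP => i; apply/negPn/negP => /h.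
  by move=> /mxrankS; rewrite mxrank1 => /leq_trans /(_ (rank_leq_row _)).
have d0 : \det (frame_mx u v w) != 0.
  have inj (x : 'rV[F]_(1 + (1 + 1))) : x *m col_mx u (col_mx v w) = 0 -> x = 0.
    rewrite -[x]hsubmxK -[rsubmx x]hsubmxK !mul_row_col.
    move: (lsubmx x) (lsubmx (rsubmx x)) (rsubmx (rsubmx x)) => y1 y2 y3.
    rewrite addrA -mul_row_col => h.
    have y30 : y3 = 0.
      apply: contraNeq hw => y3n.
      have [k kE] : exists k, y3 = k%:M by exists (y3 0 0); exact: mx11_scalar.
      have kn : k != 0 by apply: contraNneq y3n => k0; rewrite kE k0 raddf0.
      rewrite -(eqmx_scale w kn) -mul_scalar_mx -kE.
      by rewrite -[_ *m w]opprK eqmx_opp -(eqP (_ : row_mx y1 y2 *m col_mx u v == - (y3 *m w))) ?submxMl // -addr_eq0 h.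
    move: h; rewrite y30 mul0mx addr0 => h.
    have : row_mx y1 y2 = 0 by apply: (row_free_inj fr); rewrite h mul0mx.
    by rewrite -row_mx0 => /eq_row_mx [-> ->]; rewrite !row_mx0.
  by apply/det0P => -[x x0 /inj xE]; rewrite xE eqxx in x0.
have [dp|dn] : 0 < \det (frame_mx u v w) \/ \det (frame_mx u v w) < 0.
  by move: d0; rewrite neq_lt => /orP[]; [right|left].
- case: pos; first by exists w.
  by exists (-1 *: w); rewrite frame_mx_scale mulN1r oppr_lt0.
- case: pos; last by exists w.
  by exists (-1 *: w); rewrite frame_mx_scale mulN1r oppr_gt0.
Qed.

(** The columns of the inverse matrix are the basis dual to the frame; the first two give the
    projection along [w]. *)
Lemma frame_mx_coord u v w : \det (frame_mx u v w) != 0 ->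
  let N := invmx (frame_mx u v w) in
  [/\ u *m N = delta_mx 0 0, v *m N = delta_mx 0 1 & w *m N = delta_mx 0 2].
Proof.
move=> d0 N.
have h : (col_mx u (col_mx v w) *m N : 'M[F]_3) = 1%:M.
  by apply: mulmxV; rewrite unitmxE unitfE.
rewrite !mul_col_mx in h.
split; apply/rowP => j.
- by rewrite -(col_mxEu _ (col_mx (v *m N) (w *m N))) h !mxE eq_sym.
- rewrite -(col_mxEu _ (w *m N)) -(col_mxEd (u *m N)) h !mxE eq_sym; congr (_ == _)%:R.
  exact: val_inj.
- rewrite -(col_mxEd (v *m N)) -(col_mxEd (u *m N)) h !mxE eq_sym; congr (_ == _)%:R.
  exact: val_inj.
Qed.
End Frames.

(** * Opening a double point *)

Section OpeningFamily.
Variables (R : realType) (M : oriented3manifold R).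
Variables (c : R -> M) (i : atlas_index M) (a b d : R) (w : 'rV[R]_3).
Variables (rho : R -> R) (l : {linear 'rV[R]_3 -> R}).

Definition zone (t : R) := exists z : int, `|t - z%:~R - a| < d.

(** The test on [rho t] keeps [chart_inv] away from points outside the chart, where its values are
    arbitrary. The factor [sin s] bounds the push by 1 for every real [s]. *)
Definition opening (s t : R) : M :=
  if 0 < rho t then chart_inv i (chart i (c t) + (sin s * rho t) *: w) else c t.

Hypotheses (hc : immersed_curve c) (triple : no_triple_point c).
Hypotheses (nab : ~ same_param a b) (cab : c a = c b) (d0 : 0 < d).
(** The [arc_] hypotheses collect what a suitable choice of [d] and [w] ensures on the arc about
    [a]. The parameters [x] with absolute value at most 1 stand for all amplitudes
    [sin s * rho t]. *)
Hypothesis arc_dom : forall t, `|t - a| < d -> chart_dom i (c t).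
Hypothesis arc_im : forall t x, `|t - a| < d -> `|x| <= 1 ->
  (chart i @` chart_dom i) (chart i (c t) + x *: w).
Hypothesis arc_inj : forall t u x y, `|t - a| < d -> `|u - a| < d ->
  chart i (c t) + x *: w = chart i (c u) + y *: w -> t = u.
Hypothesis arc_cross : forall t u x, `|t - a| < d -> `|x| <= 1 ->
  chart_inv i (chart i (c t) + x *: w) = c u -> ~ zone u ->
  [/\ t = a, same_param b u & x = 0].
(** [l] is a coordinate blind to the push; through it the pushed arc inherits a nonzero velocity
    from [c]. *)
Hypotheses (lc : continuous l) (lw : l w = 0).
Hypothesis arc_imm : forall t, `|t - a| < d -> l (velocity i c t) != 0.
Hypotheses (rho_smooth : class_Coo setT rho) (rho_per : forall t, rho (t + 1) = rho t).
Hypotheses (rho_a : 0 < rho a) (rho01 : forall t, 0 <= rho t <= 1).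
(** Half the radius leaves a margin: [rho] vanishes on a neighbourhood of each point outside the
    zone, so the two formulas for the family glue smoothly. *)
Hypothesis rho_supp : forall t, rho t != 0 -> exists z : int, `|t - z%:~R - a| < d / 2.

Local Notation G := opening.

Let cc : closed_curve c. Proof. by case: hc. Qed.
Let sc : smooth_map c. Proof. by case: hc. Qed.
Let pc : forall t (z : int), c (t - z%:~R) = c t.
Proof. by move=> t z; rewrite -mulrNz (periodic_int cc). Qed.

Lemma zone_shift t (z : int) : zone (t + z%:~R) -> zone t.
Proof.
move=> [z' h]; exists (z' - z); rewrite mulrzBr.
by have -> : t - (z'%:~R - z%:~R) - a = t + z%:~R - z'%:~R - a by ring.
Qed.

Lemma zone_center : zone a.
Proof. by exists 0; rewrite subr0 subrr normr0. Qed.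

Lemma rho_off t : ~ zone t -> rho t = 0.
Proof.
move=> nz; apply/eqP; apply/negPn/negP => /rho_supp [z h]; apply: nz; exists z.
apply: lt_trans h _; by rewrite ltr_pdivrMr // ltr_pMr // ltr1n.
Qed.

Lemma opening_off s t : rho t = 0 -> G s t = c t.
Proof. by move=> r0; rewrite /G r0 ltxx. Qed.

Lemma amplitude s t : `|sin s * rho t| <= 1.
Proof.
have /andP[r0 r1] := rho01 t.
by rewrite normrM mulr_ile1 ?sin_max // ger0_norm.
Qed.

Lemma zone_dom t : zone t -> chart_dom i (c t).
Proof. by move=> [z /arc_dom]; rewrite pc. Qed.

Lemma opening_zoneE s t : zone t ->
  G s t = chart_inv i (chart i (c t) + (sin s * rho t) *: w).
Proof.
move=> zt; rewrite /G; case: ifPn => // r0.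
have -> : rho t = 0 by apply/le_anti; rewrite leNgt r0; case/andP: (rho01 t) => ->.
by rewrite mulr0 scale0r addr0 chart_invK //; exact: zone_dom.
Qed.

Lemma zone_im s t : zone t ->
  (chart i @` chart_dom i) (chart i (c t) + (sin s * rho t) *: w).
Proof. by move=> [z h]; rewrite -(pc t z); apply: arc_im => //; exact: amplitude. Qed.

Lemma opening_zone_dom s t : zone t -> chart_dom i (G s t).
Proof.
move=> zt; rewrite opening_zoneE //; have [x dx <-] := zone_im s zt.
by rewrite chart_invK.
Qed.

Lemma opening_zone_chart s t : zone t ->
  chart i (G s t) = chart i (c t) + (sin s * rho t) *: w.
Proof. by move=> zt; rewrite opening_zoneE // chartK //; exact: zone_im. Qed.

Lemma opening_closed s : closed_curve (G s).
Proof. by move=> t; rewrite /G rho_per cc. Qed.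

Lemma opening0 : G 0 = c.
Proof.
apply/funext => t; have [zt|nz] := pselect (zone t).
  rewrite opening_zoneE // sin0 mul0r scale0r addr0 chart_invK //; exact: zone_dom.
by rewrite opening_off // rho_off.
Qed.

(** If [u] is in the zone too, [arc_inj] forbids the crossing; otherwise [u] is not moved and
    [arc_cross] identifies the old double point. The case [sin s = 0] is kept because the lemma also
    serves for [c] itself, as [G 0]. *)
Lemma opening_cross s t u : zone t -> G s t = G s u -> ~ same_param t u ->
  [/\ sin s = 0, same_param a t & same_param b u].
Proof.
move=> zt; have [z hz] := zt.
have pG : forall t (z : int), G s (t - z%:~R) = G s t.
  by move=> t' z'; rewrite -mulrNz (periodic_int (opening_closed s)).
have zt' : zone (t - z%:~R) by exists 0; rewrite subr0.
move=> e ntu; have [zu|nzu] := pselect (zone u).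
  have [z' hz'] := zu; exfalso; apply: ntu.
  have zu' : zone (u - z'%:~R) by exists 0; rewrite subr0.
  have : chart i (G s (t - z%:~R)) = chart i (G s (u - z'%:~R)) by rewrite !pG e.
  rewrite !opening_zone_chart // => /(arc_inj hz hz') h.
  by exists (z' - z); rewrite mulrzBr addrA addrAC h subrK.
have := pG t z; rewrite opening_zoneE // e (opening_off _ (rho_off nzu)).
move=> /(arc_cross hz (amplitude _ _)) /(_ nzu) [ta bu].
rewrite ta => /eqP; rewrite mulf_eq0 (gt_eqF rho_a) orbF => /eqP s0; split=> //.
by exists z; rewrite -ta subrK.
Qed.

Lemma zone_open : open zone.
Proof.
rewrite openE => t [z h]; rewrite /interior.
have e0 : 0 < d - `|t - z%:~R - a| by rewrite subr_gt0.
near=> u; exists z.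
have h' : `|t - u| < d - `|t - z%:~R - a| by near: u; apply: cvgr_dist_lt.
have -> : u - z%:~R - a = (t - z%:~R - a) - (t - u) by ring.
rewrite (le_lt_trans (ler_normB _ _)) //; lra.
Unshelve. all: by end_near. Qed.

Lemma off_near t : ~ zone t -> \forall u \near t, rho u = 0.
Proof.
move=> nz; near=> u.
apply/eqP; apply/negPn/negP => /rho_supp [z h]; apply: nz; exists z.
have : `|t - u| < d / 2 by near: u; apply: cvgr_dist_lt => //; rewrite divr_gt0.
move=> h'; have -> : t - z%:~R - a = (t - u) + (u - z%:~R - a) by ring.
by rewrite (le_lt_trans (ler_normD _ _)) //; lra.
Unshelve. all: by end_near. Qed.

Lemma opening_off_near s t : ~ zone t -> \forall u \near t, G s u = c u.
Proof. by move=> /off_near; apply: filterS => u; exact: opening_off. Qed.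

Let class_C_snd (W : normedModType R) k (A : set R) (B : set (R * R)) (g : R -> W) :
  open B -> (forall p, B p -> A p.2) -> class_C k A g -> class_C k B (fun p => g p.2).
Proof.
move=> oB BA cg; have -> : (fun p : R * R => g p.2) = fun p => g (p.2 + 0).
  by apply/funext => p; rewrite addr0.
apply: (class_C_precomp (L := @snd R R) oB _ _ cg) => [p|p /BA]; last by rewrite addr0.
exact: cvg_snd.
Qed.

Let class_C_fst (W : normedModType R) k (A : set R) (B : set (R * R)) (g : R -> W) :
  open B -> (forall p, B p -> A p.1) -> class_C k A g -> class_C k B (fun p => g p.1).
Proof.
move=> oB BA cg; have -> : (fun p : R * R => g p.1) = fun p => g (p.1 + 0).
  by apply/funext => p; rewrite addr0.
apply: (class_C_precomp (L := @fst R R) oB _ _ cg) => [p|p /BA]; last by rewrite addr0.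
exact: cvg_fst.
Qed.

Let open_snd (A : set R) : open A -> open [set p : R * R | A p.2].
Proof. by move=> oA; apply: (open_comp (f := snd)) => // p _; exact: cvg_snd. Qed.

Lemma opening_smooth : smooth_family G.
Proof.
move=> [s t]; have [zt|nz] := pselect (zone t).
  have oU := open_snd zone_open.
  exists i, [set p | zone p.2]; split=> //.
    by move=> _ [p zp <-]; exact: opening_zone_dom.
  move=> k.
  have h1 : class_C k [set p : R * R | zone p.2] (fun p => (chart i \o c) p.2).
    apply: (class_C_snd oU _ (smooth_map_chart i sc k)) => p; exact: zone_dom.
  have h2 : class_C k [set p : R * R | zone p.2] (fun p => 1 * sin p.1 + 0 * cos p.1 : R).
    exact: (class_C_fst (g := fun x => 1 * sin x + 0 * cos x) oU _ (class_Coo_trig 1 0 k)).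
  have h3 : class_C k [set p : R * R | zone p.2] (fun p => rho p.2).
    exact: (class_C_snd oU _ (rho_smooth k)).
  have h4 := class_C_scale oU h2 h3.
  apply: (class_C_eq oU _ (class_CD oU h1 (class_C_scale oU h4 (class_C_cst _ _ w)))).
  move=> p zp /=; rewrite opening_zone_chart //.
  by rewrite mul1r mul0r addr0.
have [j [U [oU Ut cU sU]]] := sc t.
have [A [[oA At] hA]] : exists A, open_nbhs t A /\ forall u, A u -> rho u = 0.
  have : nbhs t [set u | rho u = 0] by exact: off_near nz.
  by rewrite nbhsE => -[A oA hA]; exists A.
have oUA := open_snd (openI oU oA).
exists j, [set p | (U `&` A) p.2]; split=> //.
  move=> _ [p [Up Ap] <-]; rewrite opening_off ?hA //.
  by apply: cU; exists p.2.
move=> k.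
have h : class_C k [set p : R * R | (U `&` A) p.2] (fun p => (chart j \o c) p.2).
  by apply: (class_C_snd oUA _ (sU k)) => p [].
apply: (class_C_eq oUA _ h) => p [_ Ap] /=.
by rewrite opening_off // hA.
Qed.

Lemma opening_smooth_at s : smooth_map (G s).
Proof.
move=> t; have [j [U [oU Ut cU sU]]] := opening_smooth (s, t).
(* Freezing [s] is precomposition with the affine map sending u to (s, u). *)
pose L (u : R) : R * R := u *: (0, 1).
have linL : linear L by move=> x u v; rewrite /L scalerDl scalerA.
pose L' : {linear R -> (R * R)%type} := HB.pack L (GRing.isLinear.Build R R (R * R)%type _ L linL).
have LE u : L' u + (s, 0) = (s, u).
  transitivity (u * 0 + s, u * 1 + 0) => //.
  by rewrite mulr0 mulr1 add0r addr0.
have cL : continuous L' by move=> u; exact: scalel_continuous.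
have oV : open [set u | U (s, u)].
  have -> : [set u | U (s, u)] = (fun u => L' u + (s, 0)) @^-1` U.
    by apply/seteqP; split=> u /=; rewrite LE.
  apply: open_comp => // u _; apply: continuousD; [exact: cL|exact: cvg_cst].
exists j, [set u | U (s, u)]; split=> //.
  by move=> _ [u Uu <-]; apply: cU; exists (s, u).
move=> k.
have h : class_C k [set u | U (s, u)]
    (fun u => (chart j \o (fun z => G z.1 z.2)) (L' u + (s, 0))).
  by apply: (class_C_precomp oV cL _ (sU k)) => u; rewrite LE.
by apply: (class_C_eq oV _ h) => u _; rewrite LE.
Qed.

(** Since [sin s] is positive on this range, [opening_cross] keeps crossings out of the zone, where
    the curve is still [c]. Such a crossing at [c a] would make a triple point with the parameter
    [a]. *)
Lemma opening_off_cross s t u : 0 < s <= 1 -> ~ same_param t u -> G s t = G s u ->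
  [/\ ~ zone t, ~ zone u, c t = c u & c t <> c a].
Proof.
move=> /andP[s0 s1] ntu e.
have sn : sin s <> 0 by apply/eqP; rewrite gt_eqF // sin2_gt0 // s0 /=; lra.
have nz t' u' : ~ same_param t' u' -> G s t' = G s u' -> ~ zone t'.
  by move=> n e' zt; case: (opening_cross zt e' n).
have nzt := nz _ _ ntu e.
have nzu : ~ zone u by apply: nz (esym e) => /same_param_sym.
have ctu : c t = c u.
  by rewrite -(opening_off s (rho_off nzt)) e (opening_off s (rho_off nzu)).
split=> // cta.
have out t' : same_param a t' -> ~ zone t' -> False.
  by move=> [z ->]; apply; exists z; rewrite addrK subrr normr0.
have [h|h|h] := triple (esym cta) ctu; [exact: (out t)|exact: ntu|exact: (out u)].
Qed.

(** [opening_cross] at time 0 shows that the other double points of [c] have no parameter in the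
    zone. *)
Lemma opening_double t u s : ~ same_param t u -> c t = c u -> c t <> c a -> G s t = c t.
Proof.
move=> ntu ctu cta; rewrite opening_off // rho_off // => zt.
have e : G 0 t = G 0 u by rewrite opening0.
have [_ [z tE] _] := opening_cross zt e ntu; apply: cta.
by rewrite tE (periodic_int cc).
Qed.

Lemma double_points_opening s x : 0 < s <= 1 ->
  double_points (G s) x <-> double_points c x /\ x <> c a.
Proof.
move=> hs; split=> [[t [u [ntu <- e]]]|[[t [u [ntu <- e]]] na]].
  have [nt nu e' na] := opening_off_cross hs ntu (esym e).
  rewrite opening_off ?rho_off //; split=> //.
  by exists t, u; split.
have nut : ~ same_param u t by move=> /same_param_sym.
exists t, u; split=> //; first exact: (opening_double s ntu (esym e) na).
by rewrite (opening_double s nut) ?e.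
Qed.

Lemma opening_immersed s : immersed_curve (G s).
Proof.
have cG := opening_closed s; have sG := opening_smooth_at s.
split=> // t j dj; have [[z hz]|nz] := pselect (zone t); last first.
  have n := opening_off_near s nz.
  rewrite (velocity_near _ n); case: hc => _ _; apply.
  by rewrite -(nbhs_singleton n).
have tE : t = (t - z%:~R) + z%:~R by rewrite subrK.
rewrite tE (velocity_periodic _ _ _ cG).
have zt : zone (t - z%:~R) by exists 0; rewrite subr0.
apply: (velocity_neq0_change (i := i)) => //; first exact: opening_zone_dom.
  by rewrite -mulrNz (periodic_int cG).
apply: contraNneq (arc_imm hz) => v0.
rewrite linear_velocity //; last exact: arc_dom.
suff -> : 'D_1 (l \o (chart i \o c)) (t - z%:~R) = 'D_1 (l \o (chart i \o G s)) (t - z%:~R).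
  by rewrite -linear_velocity ?v0 ?linear0 //; exact: opening_zone_dom.
apply: near_eq_derive; apply: filterS (open_nbhs_nbhs (conj zone_open zt)) => u zu /=.
by rewrite opening_zone_chart // linearD linearZ lw /= scaler0 addr0.
Qed.

Lemma opening_labelled n (p : 'I_n.+1 -> M) j s : is_labelled_knot c p ->
  p j = c a -> 0 < s <= 1 -> is_labelled_knot (G s) (p \o lift j).
Proof.
move=> [_ _ tr pinj prange] pj hs; split.
- exact: opening_immersed.
- move=> t u v e1 e2; apply: contrapT => h.
  have ntu : ~ same_param t u by move=> ?; apply: h; constructor 1.
  have nuv : ~ same_param u v by move=> ?; apply: h; constructor 2.
  have [_ _ e1' _] := opening_off_cross hs ntu e1.
  have [_ _ e2' _] := opening_off_cross hs nuv e2.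
  exact: h (triple e1' e2').
- move=> t u k ntu e dk.
  have [zt zu e' _] := opening_off_cross hs ntu e.
  have nt := opening_off_near s zt; have nu := opening_off_near s zu.
  rewrite (velocity_near _ nt) (velocity_near _ nu).
  by apply: tr => //; rewrite -(nbhs_singleton nt).
- exact: inj_comp pinj lift_inj.
- apply/seteqP; split=> [_ [k _ <-]|x] /=.
    apply/(double_points_opening _ hs); split; first by rewrite -prange; exists (lift j k).
    by rewrite -pj => /pinj /eqP; rewrite eq_sym (negbTE (neq_lift _ _)).
  move=> /(double_points_opening _ hs) [].
  rewrite -prange => -[k _ <-] nk; case: (unliftP j k) => [k' ->|kj]; first by exists k'.
  by case: nk; rewrite kj.
Qed.

(** The base parameter may lie in the zone, so the base point itself may move. Crossings of [G s]
    are nevertheless crossings of [c] at the same parameters, so neither the base point nor the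
    order of the remaining labels is disturbed. *)
Lemma opening_based n (p : 'I_n.+1 -> M) j s t0 : is_based_knot c p t0 ->
  p j = c a -> 0 < s <= 1 -> is_based_knot (G s) (p \o lift j) t0.
Proof.
move=> [lab nb ord] pj hs; split; first exact: opening_labelled.
- move=> [t [u [ntu e1 e2]]]; apply: nb.
  (* Two inequivalent parameters cannot both be equivalent to [t0]; the one that is not gives a
     genuine crossing with [t0]. *)
  have : ~ same_param t t0 \/ ~ same_param u t0.
    apply: contrapT => /not_orP [/contrapT h1 /contrapT h2]; apply: ntu.
    exact: same_param_trans h1 (same_param_sym h2).
  case=> h; [have [_ _ e _] := opening_off_cross hs h e1|have [_ _ e _] := opening_off_cross hs h e2].
    by exists t, t0; split.
  by exists u, t0; split.
have [_ _ _ pinj prange] := lab.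
have npa k : p (lift j k) <> c a.
  by rewrite -pj => /pinj /eqP; rewrite eq_sym (negbTE (neq_lift _ _)).
have [_ _ _ _ prange'] := opening_labelled lab pj hs.
move=> k k' kk'; have [|t [ht ct hfirst]] := ord (lift j k) (lift j k').
  by rewrite /= ltnNge leq_bump2 -ltnNge.
exists t; split=> //.
  have : double_points c (p (lift j k)) by rewrite -prange; exists (lift j k).
  move=> [u [v [nuv cu cv]]].
  have : ~ same_param t u \/ ~ same_param t v.
    apply: contrapT => /not_orP [/contrapT h1 /contrapT h2]; apply: nuv.
    exact: same_param_trans (same_param_sym h1) h2.
  by case=> h; rewrite (opening_double s h) ?ct ?cu ?cv //.
move=> u hu /= Gu; apply: hfirst => //.
have : double_points (G s) (p (lift j k')) by rewrite -prange'; exists k'.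
move=> [v [v' [nv e1 e2]]].
have : ~ same_param u v \/ ~ same_param u v'.
  apply: contrapT => /not_orP [/contrapT h1 /contrapT h2]; apply: nv.
  exact: same_param_trans (same_param_sym h1) h2.
case=> h; [have e := etrans Gu (esym e1)|have e := etrans Gu (esym e2)].
  by have [nz _ _ _] := opening_off_cross hs h e; rewrite -Gu opening_off // rho_off.
by have [nz _ _ _] := opening_off_cross hs h e; rewrite -Gu opening_off // rho_off.
Qed.

(** At time 0 the branch through [b] stands still, while the branch through [a] has velocity
    [rho a *: w] because sin has derivative 1 at 0; the positive factor [rho a] does not alter the
    sign. *)
Lemma opening_opens eps :
  (let D := \det (col_mx (velocity i c a) (col_mx (velocity i c b) w) : 'M[R]_3) in
   if eps then 0 < D else D < 0) ->
  opens_double_point eps G (c a).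
Proof.
move=> hD; exists a, b, i; rewrite opening0; split=> //.
  by apply: arc_dom; rewrite subrr normr0.
have nzb : ~ zone b.
  move=> zb; have e : G 0 b = G 0 a by rewrite opening0.
  have nba : ~ same_param b a by move=> /same_param_sym.
  by have [_ ab _] := opening_cross zb e nba.
have -> : velocity i (G ^~ b) 0 = 0.
  have -> : G ^~ b = cst (c b) by apply/funext => s; rewrite opening_off // rho_off.
  by rewrite /velocity (_ : _ \o _ = cst (chart i (c b))) // derive_cst.
have -> : velocity i (G ^~ a) 0 = rho a *: w.
  have E : chart i \o (G ^~ a) = fun s => chart i (c a) + (sin s * rho a) *: w.
    by apply/funext => s /=; rewrite opening_zone_chart //; exact: zone_center.
  rewrite /velocity E.
  have dsin : is_derive (0 : R) (1 : R) (fun s : R => sin s * rho a) (rho a).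
    apply: is_derive_eq (is_deriveM (is_derive_sin (0 : R)) (is_derive_cst (rho a) _ _)) _.
    by rewrite cos0 scaler0 add0r [_ *: _]mulr1.
  have df : differentiable (fun s : R => sin s * rho a) (0 : R).
    by apply/derivable1_diffP; case: dsin.
  have h := diff_scale df (differentiable_cst w (0 : R)).
  have ds : differentiable (fun s : R => (sin s * rho a) *: w) 0 by case: h.
  have dcst : differentiable (fun=> chart i (c a) : 'rV[R]_3) (0 : R) by exact: differentiable_cst.
  rewrite deriveD; [|exact: diff_derivable|exact: diff_derivable].
  rewrite derive_cst add0r deriveE // (@diff_val _ _ _ _ _ _ _ h) diff_cst /=.
  by rewrite scaler0 add0r -deriveE // derive_val.
rewrite /= subr0 frame_mx_scale.
by case: eps hD => /= hD; rewrite ?pmulr_rgt0 ?pmulr_rlt0.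
Qed.
End OpeningFamily.

(** * Choice of the constants and existence of resolutions *)

Section Resolutions.
Variables (R : realType) (M : oriented3manifold R).

Lemma linear_rV_continuous n (l : {linear 'rV[R]_n.+1 -> R}) : continuous l.
Proof.
have -> : (l : 'rV[R]_n.+1 -> R) = fun w => \sum_j coordinate j w *: l (delta_mx 0 j).
  apply/funext => w; rewrite [in LHS](row_sum_delta w) linear_sum.
  by apply: eq_bigr => j _; rewrite linearZ.
suff h : class_C 0 setT (fun w : 'rV[R]_n.+1 => \sum_j coordinate j w *: l (delta_mx 0 j)).
  by move=> w; exact: h.
apply: class_C_sum => [|j]; first exact: openT.
apply: class_C_scale; [exact: openT| |exact: class_C_cst].
by move=> w _; exact: coord_continuous.
Qed.

Definition frame_coord (N : 'M[R]_3) (j : 'I_3) : {linear 'rV[R]_3 -> R} :=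
  @coordinate R 3 j \o mulmxr N.

(** By periodicity, parameters in [0, 1] suffice; the image of a compact set in a Hausdorff space is
    closed. *)
Lemma closed_away_from_zones (c : R -> M) (a b d : R) :
  closed_curve c -> continuous c -> closed (c @` ~` (zone a d `|` zone b d)).
Proof.
move=> cc cont; set A := ~` _.
have cA : closed A by apply: open_closedC; apply: openU; exact: zone_open.
have -> : c @` A = c @` (`[0, 1] `&` A).
  apply/seteqP; split=> [_ [t At <-]|_ [t [_ At] <-]]; last by exists t.
  exists (t - (Num.floor t)%:~R).
    split.
      rewrite /= in_itv /=; have /andP[] := floor_itv t; rewrite intrD1; lra.
    by move=> [|] h; apply: At; [left|right]; apply: (zone_shift (z := - Num.floor t)); rewrite mulrNz.
  by rewrite -mulrNz (periodic_int cc).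
apply: compact_closed; first exact: manifold_hausdorff.
apply: continuous_compact; first exact: continuous_subspaceT.
by apply: compact_closedI => //; exact: segment_compact.
Qed.

(** The family is built from the bare curve and two parameters; labels and base point enter only
    afterwards, so one construction serves both complexes. *)
Lemma resolving_family (c : R -> M) (a b : R) (eps : bool) :
  immersed_curve c -> no_triple_point c -> transverse_double_points c ->
  ~ same_param a b -> c a = c b ->
  exists G : R -> R -> M,
  [/\ smooth_family G, G 0 = c, opens_double_point eps G (c a),
    forall n (p : 'I_n.+1 -> M) j s, is_labelled_knot c p ->
      p j = c a -> 0 < s <= 1 -> is_labelled_knot (G s) (p \o lift j) &
    forall n (p : 'I_n.+1 -> M) j s t0, is_based_knot c p t0 ->
      p j = c a -> 0 < s <= 1 -> is_based_knot (G s) (p \o lift j) t0].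
Proof.
move=> hc triple tr nab cab; have [cc sc _] := hc.
have cont := smooth_map_continuous sc.
have [i da] := chart_cover (c a); have db : chart_dom i (c b) by rewrite -cab.
have [w0 hw0] := frame_mx_complete eps (tr a b i nab cab da).
have det0 : \det (frame_mx (velocity i c a) (velocity i c b) w0) != 0.
  by case: (eps) hw0 => h; [rewrite gt_eqF|rewrite lt_eqF].
have [Na Nb Nw] := frame_mx_coord det0.
set N := invmx _ in Na Nb Nw.
(* Coordinates dual to the frame formed by the two velocities and [w0]: [l 0] and [l 1] do not see
   the push, [l 2] measures it. *)
pose l j := frame_coord N j.
have lc j : continuous (l j) by exact: linear_rV_continuous.
pose f j := l j \o (chart i \o c).
pose U := c @^-1` chart_dom i.
have oU : open U by exact: open_preimage_chart.
have sf j : class_Coo U (f j).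
  by move=> k; apply: class_C_linear => //; exact: smooth_map_chart.
have fd j t : U t -> derivable (f j) t 1.
  by move=> Ut; have [df _] := sf j 1; apply/derivable1_diffP/df.
have fcont j t : U t -> {for t, continuous ('D_1 (f j))}.
  by move=> Ut; have [_ /(_ 1)] := sf j 1; apply.
have fE j t : U t -> 'D_1 (f j) t = l j (velocity i c t).
  by move=> Ut; rewrite linear_velocity.
have lE j y : l j y = (y *m N) 0 j by [].
have fa0 : 'D_1 (f 0) a = 1 by rewrite fE // lE Na mxE eqxx.
have fa1 : 'D_1 (f 1) a = 0 by rewrite fE // lE Na mxE.
have fb0 : 'D_1 (f 0) b = 0 by rewrite fE // lE Nb mxE.
have fb1 : 'D_1 (f 1) b = 1 by rewrite fE // lE Nb mxE eqxx.
have big t j : U t -> 'D_1 (f j) t = 1 -> \forall u \near t, 2^-1 < 'D_1 (f j) u.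
  move=> Ut e; apply: (cvgr_gt _ (fcont j t Ut)); rewrite e; lra.
have small t j : U t -> 'D_1 (f j) t = 0 -> \forall u \near t, `|'D_1 (f j) u| < 2^-1.
  move=> Ut e; apply: (cvgr_norm_lt _ (fcont j t Ut)); rewrite e normr0 invr_gt0; lra.
have nU t : U t -> \forall u \near t, U u.
  by move=> Ut; apply: open_nbhs_nbhs.
have [d1 d1p h1] := near_interval (filterI (nU a da) (filterI (big a 0 da fa0) (small a 1 da fa1))).
have [d2 d2p h2] := near_interval (filterI (nU b db) (filterI (small b 0 db fb0) (big b 1 db fb1))).
pose D := Num.min d1 d2.
have D0 : 0 < D by rewrite lt_min d1p.
have hD1 t : `|t - a| < D -> [/\ U t, 2^-1 < 'D_1 (f 0) t & `|'D_1 (f 1) t| < 2^-1].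
  by rewrite lt_min => /andP[/h1 [? [? ?]] _].
have hD2 t : `|t - b| < D -> [/\ U t, `|'D_1 (f 0) t| < 2^-1 & 2^-1 < 'D_1 (f 1) t].
  by rewrite lt_min => /andP[_ /h2 [? [? ?]]].
(* The rest of the curve is cut out with [D], not with the final radius [d]: the latter depends on
   [r], which depends on [A]. No triple points means that [c] does not return to [c a] on [A]. *)
pose A := ~` (zone a D `|` zone b D).
have nA : ~ (c @` A) (c a).
  move=> [t At e]; have out z : (same_param z t -> zone z D t).
    by move=> [k ->]; exists k; rewrite addrK subrr normr0.
  have [h|h|h] := triple t a b e cab.
  - by apply: At; left; apply/out/same_param_sym.
  - exact: nab.
  - by apply: At; right; apply/out/same_param_sym.
have : \forall y \near chart i (c a),
    (chart i @` chart_dom i) y /\ ~ (c @` A) (chart_inv i y).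
  apply: filterI.
    by apply: open_nbhs_nbhs; split; [exact: chart_im_open|exists (c a)].
  apply: (@chart_inv_continuous _ M i (chart i (c a)) _ (~` (c @` A))); first by exists (c a).
  apply: open_nbhs_nbhs; split; last by rewrite chart_invK.
  by apply: closed_openC; exact: closed_away_from_zones.
move=> /nbhs_normP [r /= r0 hr].
(* Half of [r] is spent on moving from [c a] to [c t] along the curve, half on the push. *)
have r20 : 0 < r / 2 by rewrite divr_gt0.
have : \forall t \near a, `|chart i (c a) - chart i (c t)| < r / 2.
  by apply: (cvgr_dist_lt (F := nbhs a)) => //; exact: (smooth_map_chart i sc 0%N a da).
move=> /near_interval [d3 d3p h3].
pose d := Num.min D d3.
have d0 : 0 < d by rewrite lt_min D0.
have dD t : `|t - a| < d -> `|t - a| < D by rewrite lt_min => /andP[].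
have dd3 t : `|t - a| < d -> `|chart i (c a) - chart i (c t)| < r / 2.
  by rewrite lt_min => /andP[_ /h3].
(* Shrinks [w0] to norm at most r / 2; the added 1 makes the denominator evidently positive, and
   [k > 0] keeps the sign of the frame. *)
pose k := r / 2 / (`|w0| + 1).
have w1 : 0 < `|w0| + 1 by rewrite ltr_wpDl.
have k0 : 0 < k by rewrite divr_gt0.
pose w := k *: w0.
have lZ j : l j w = k * l j w0 by exact: linearZ.
have lw0 : l 0 w = 0 by rewrite lZ lE Nw mxE mulr0.
have lw1 : l 1 w = 0 by rewrite lZ lE Nw mxE mulr0.
have lw2 : l 2 w = k by rewrite lZ lE Nw mxE eqxx mulr1.
have nw : `|w| <= r / 2.
  rewrite normrZ (gtr0_norm k0) /k mulrAC ler_pdivrMr // ler_pM2l // lerDl.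
  exact: ler01.
have ball_in t x : `|t - a| < d -> `|x| <= 1 ->
    (chart i @` chart_dom i) (chart i (c t) + x *: w) /\
    ~ (c @` A) (chart_inv i (chart i (c t) + x *: w)).
  move=> ht hx; apply: hr; rewrite /= opprD addrA.
  apply: le_lt_trans (ler_normB _ _) _; rewrite normrZ.
  have : `|x| * `|w| <= r / 2.
    by apply: le_trans nw; exact: ler_piMl.
  by have := dd3 t ht; lra.
have fj j t x : l j w = 0 -> l j (chart i (c t) + x *: w) = f j t.
  by move=> lw; rewrite linearD linearZ lw /= scaler0 addr0.
have f0inj t u : `|t - a| < D -> `|u - a| < D -> f 0 t = f 0 u -> t = u.
  move=> ht hu e.
  have dfD v : `|v - a| < D -> derivable (f 0) v 1 by move=> /hD1 [Uv _ _]; exact: fd.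
  have [z hz] := mean_value_ball dfD ht hu; rewrite e subrr => /esym/eqP.
  have [_ z1 _] := hD1 _ hz; rewrite mulf_eq0 subr_eq0 => /orP[/eqP z0|/eqP //].
  by move: z1; rewrite z0; lra.
have arc_dom t : `|t - a| < d -> chart_dom i (c t) by move=> /dD /hD1 [].
have arc_im t x : `|t - a| < d -> `|x| <= 1 ->
    (chart i @` chart_dom i) (chart i (c t) + x *: w) by move=> ht hx; case: (ball_in t x ht hx).
have arc_inj t u x y : `|t - a| < d -> `|u - a| < d ->
    chart i (c t) + x *: w = chart i (c u) + y *: w -> t = u.
  move=> ht hu e; apply: f0inj; [exact: dD|exact: dD|].
  by rewrite -(fj 0 t x lw0) e fj.
have arc_cross t u x : `|t - a| < d -> `|x| <= 1 ->
    chart_inv i (chart i (c t) + x *: w) = c u -> ~ zone a d u ->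
    [/\ t = a, same_param b u & x = 0].
  move=> ht hx e nz; have [im nAu] := ball_in t x ht hx.
  have Au : (zone a D `|` zone b D) u.
    by apply: contrapT => h; apply: nAu; exists u.
  have sh (z : int) : chart i (c (u - z%:~R)) = chart i (c t) + x *: w.
    by rewrite -mulrNz (periodic_int cc) -e chartK.
  (* Near [a], injectivity of [f 0] puts [u] into the smaller zone, a contradiction. Near [b],
     equality of both plane coordinates pins down the two parameters. *)
  case: Au => -[z hz].
    exfalso; apply: nz; exists z; rewrite (_ : u - z%:~R = t) //.
    apply: f0inj => //; first exact: dD.
    by rewrite -(fj 0 t x lw0) -(sh z).
  have e0 : f 0 t = f 0 (u - z%:~R) by rewrite -(fj 0 t x lw0) -(sh z).
  have e1 : f 1 t = f 1 (u - z%:~R) by rewrite -(fj 1 t x lw1) -(sh z).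
  have HA v : `|v - a| < D -> [/\ derivable (f 0) v 1, derivable (f 1) v 1,
      2^-1 < 'D_1 (f 0) v & `|'D_1 (f 1) v| < 2^-1].
    by move=> /hD1 [Uv v1 v2]; split=> //; exact: fd.
  have HB v : `|v - b| < D -> [/\ derivable (f 0) v 1, derivable (f 1) v 1,
      `|'D_1 (f 0) v| < 2^-1 & 2^-1 < 'D_1 (f 1) v].
    by move=> /hD2 [Uv v1 v2]; split=> //; exact: fd.
  have fab j : f j a = f j b by rewrite /f /= cab.
  have [ta ub] := transverse_isolated HA HB (fab 0) (fab 1) (dD t ht) hz e0 e1.
  split=> //; first by exists z; rewrite -ub subrK.
  (* With both parameters at the double point, the third coordinate leaves x k = 0. *)
  have := congr1 (l 2) (sh z); rewrite ub ta -cab linearD linearZ lw2 /=.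
  move=> /eqP; rewrite -subr_eq0 opprD addrA subrr add0r oppr_eq0.
  by rewrite mulf_eq0 (gt_eqF k0) orbF => /eqP.
have arc_imm t : `|t - a| < d -> l 0 (velocity i c t) != 0.
  by move=> /dD /hD1 [Ut h _]; rewrite -fE // gt_eqF //; lra.
have [rho [rs rp ra r01 rsup]] := periodic_bump a (divr_gt0 d0 (ltr0n _ 2)).
exists (opening c i w rho); split.
- exact: (opening_smooth hc d0 arc_dom arc_im rs r01 rsup).
- exact: (@opening0 _ _ c i a d w rho hc d0 arc_dom r01 rsup).
- apply: (opening_opens hc nab cab d0 arc_dom arc_im arc_inj arc_cross rp ra r01 rsup).
  rewrite /= frame_mx_scale; case: (eps) hw0 => h; rewrite ?pmulr_rgt0 ?pmulr_rlt0 //.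
- move=> n p j s; exact: (opening_labelled hc triple d0 arc_dom arc_im arc_inj arc_cross (lc 0) lw0 arc_imm rs rp ra r01 rsup).
- move=> n p j s t0; exact: (opening_based hc triple d0 arc_dom arc_im arc_inj arc_cross (lc 0) lw0 arc_imm rs rp ra r01 rsup).
Qed.

Lemma path01_cst (T : topologicalType) (x : T) : path01 (fun _ : R => x).
Proof. by apply: continuous_subspaceT => t; exact: cvg_cst. Qed.

(** The remaining double points do not move along the family, so constant paths of labels
    suffice. *)
Lemma label_resolution_exists eps n (i : 'I_n.+1) (K : labelled_knot M n.+1) :
  exists K', label_resolves eps i K K'.
Proof.
have lab := lkP K; have [hc triple tr _ prange] := lab.
have : double_points (lk_curve K) (lk_label K i) by rewrite -prange; exists i.
move=> [a [b [nab ca cb]]].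
have [G [sG G0 oG lG _]] := resolving_family eps hc triple tr nab (etrans ca (esym cb)).
have l1 : is_labelled_knot (G 1) (lk_label K \o lift i).
  by apply: lG => //; rewrite ltr01 lexx.
exists (LabelledKnot l1), G, (fun=> lk_label K \o lift i); split=> //.
- by split=> // j; exact: path01_cst.
- by move=> s; apply: lG.
- by rewrite -ca.
Qed.

Lemma base_resolution_exists eps n (i : 'I_n.+1) (K : based_knot M n.+1) :
  exists K', base_resolves eps i K K'.
Proof.
have bas := bkP K; have [lab _ _] := bas; have [hc triple tr _ prange] := lab.
have : double_points (bk_curve K) (bk_label K i) by rewrite -prange; exists i.
move=> [a [b [nab ca cb]]].
have [G [sG G0 oG _ bG]] := resolving_family eps hc triple tr nab (etrans ca (esym cb)).
have l1 : is_based_knot (G 1) (bk_label K \o lift i) (bk_base K).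
  by apply: bG => //; rewrite ltr01 lexx.
exists (BasedKnot l1), G, (fun=> bk_label K \o lift i), (fun=> bk_base K); split=> //.
- by split=> // *; exact: path01_cst.
- by move=> s; apply: bG.
- by rewrite -ca.
Qed.
End Resolutions.

(** * Base points *)

Section BasedKnots.
Variables (R : realType) (M : oriented3manifold R).

Lemma same_param_itv (b t u : R) : b <= t < b + 1 -> b <= u < b + 1 ->
  same_param t u -> t = u.
Proof.
move=> /andP[t1 t2] /andP[u1 u2] h; apply/esym; apply: same_param_near h.
by rewrite ltr_norml; lra.
Qed.

Lemma same_param_repr (b t : R) : exists2 u, b <= u < b + 1 & same_param t u.
Proof.
exists (t - (Num.floor (t - b))%:~R); last by exists (- Num.floor (t - b)); rewrite mulrNz.
by have /andP[] := floor_itv (t - b); rewrite intrD1; lra.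
Qed.

Lemma same_paramE (c : R -> M) t u : closed_curve c -> same_param t u -> c u = c t.
Proof. by move=> cc [z ->]; rewrite (periodic_int cc). Qed.

(** Pigeonhole: without triple points, [n] points account for at most 2n parameters modulo integers,
    and 2n + 1 equally spaced ones are tested. *)
Lemma nondouble_param n (c : R -> M) (p : 'I_n -> M) : no_triple_point c ->
  exists b, ~ range p (c b).
Proof.
move=> triple; apply: contrapT => /forallNP h.
have hp t : {k | p k = c t}.
  by apply: cid; have /contrapT [k _ e] := h t; exists k.
pose m := (2 * n).+1.
pose tt (k : 'I_m) : R := k%:R / m%:R.
have m0 : 0 < m%:R :> R by rewrite ltr0n.
have tt_inj k l : same_param (tt k) (tt l) -> k = l.
  have in01 k' : 0 <= tt k' < 0 + 1.
    by rewrite divr_ge0 //= add0r ltr_pdivrMr // mul1r ltr_nat.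
  move=> /(same_param_itv (in01 k) (in01 l)) /(congr1 (fun x => x * m%:R)).
  by rewrite !divfK ?gt_eqF // => /eqP; rewrite eqr_nat => /eqP /val_inj.
pose F (k : 'I_m) : 'I_n := sval (hp (tt k)).
have FE k : p (F k) = c (tt k) by exact: svalP (hp (tt k)).
have fib (j : 'I_n) : (#|[pred k | F k == j]| <= 2)%N.
  rewrite leqNgt; apply/negP => /card_gt2P [x [y [z [[xA yA zA] [nxy nyz nzx]]]]].
  have [xj yj zj] : [/\ F x = j, F y = j & F z = j] by split; apply/eqP.
  have e k l : F k = j -> F l = j -> c (tt k) = c (tt l) by move=> kj lj; rewrite -!FE kj lj.
  have [/tt_inj|/tt_inj|/tt_inj] := triple _ _ _ (e x y xj yj) (e y z yj zj).
  - by move/eqP; rewrite (negbTE nxy).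
  - by move/eqP; rewrite (negbTE nyz).
  - by move/eqP; rewrite eq_sym (negbTE nzx).
have : (m <= 2 * n)%N.
  rewrite -[m in leqLHS]card_ord -sum1_card (partition_big F xpredT) //=.
  have -> : (2 * n = \sum_(j < n) 2)%N by rewrite sum_nat_const card_ord mulnC.
  by apply: leq_sum => j _; rewrite sum1_card; exact: fib.
by rewrite ltnn.
Qed.

(** Exactly two parameters of a fundamental interval lead to a double point, so the first meeting is
    a minimum of two numbers. *)
Lemma first_param (c : R -> M) x b : closed_curve c -> no_triple_point c ->
  double_points c x ->
  exists t, [/\ b <= t < b + 1, c t = x & forall u, b <= u < b + 1 -> c u = x -> t <= u].
Proof.
move=> cc triple [t [u [ntu ct cu]]].
have [t' ht tt'] := same_param_repr b t; have [u' hu uu'] := same_param_repr b u.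
have ct' : c t' = x by rewrite (same_paramE cc tt').
have cu' : c u' = x by rewrite (same_paramE cc uu').
have ntu' : ~ same_param t' u'.
  move=> h; apply: ntu; apply: same_param_trans tt' (same_param_trans h _).
  exact: same_param_sym.
have two v : b <= v < b + 1 -> c v = x -> v = t' \/ v = u'.
  move=> hv cv.
  have [h|h|h] := triple v t' u' (etrans cv (esym ct')) (etrans ct' (esym cu')).
  - by left; exact: same_param_itv hv ht h.
  - by [].
  - by right; exact: same_param_itv hv hu h.
have [le|lt] := leP t' u'.
  by exists t'; split=> // v hv cv; have [->|->] := two v hv cv.
by exists u'; split=> // v hv cv; have [->|->] := two v hv cv; rewrite ?lexx ?ltW.
Qed.

Lemma sort_injective n (f : 'I_n -> R) : injective f ->
  exists s : 'I_n -> 'I_n, [/\ injective s, forall i, exists j, s j = i &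
    forall i j : 'I_n, (i < j)%N -> f (s i) < f (s j)].
Proof.
move=> finj.
pose e := sort (relpre f <=%R) (enum 'I_n).
have se : size e = n by rewrite size_sort size_enum_ord.
have ue : uniq e by rewrite sort_uniq enum_uniq.
have le_e : sorted (relpre f <=%R) e by apply: sort_sorted => x y; exact: le_total.
have me i : i \in e by rewrite mem_sort mem_enum.
case: n f finj e se ue le_e me => [|n] f finj e se ue le_e me; first by exists id; split=> // -[].
have oe : sorted (relpre f <%R) e.
  have E r : sorted (relpre f r) e = sorted r (map f e) by rewrite sorted_map.
  by rewrite E lt_sorted_uniq_le map_inj_uniq // ue /= -E.
exists (fun i => nth ord0 e i); split.
- move=> i j /eqP; rewrite nth_uniq ?se // => /eqP; exact: val_inj.
- move=> i.
  have lt : (index i e < n.+1)%N by rewrite -[n.+1 in X in (_ < X)%N]se index_mem.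
  by exists (Ordinal lt); rewrite nth_index.
- move=> i j ij; have tr : transitive (relpre f <%R) by move=> x y z; exact: lt_trans.
  by apply: (sorted_ltn_nth tr ord0 oe) => //; rewrite inE se.
Qed.

(** Any labelling becomes admissible after permuting it by the [s] that sorts the parameters of
    first meeting. *)
Lemma based_knot_exists n (K : singular_knot M n) :
  exists B : based_knot M n, bk_curve B = sk_curve K.
Proof.
have [p lab] := skP K; have [[cc sc im] triple tr pinj prange] := lab.
have [b hb] := nondouble_param p triple; rewrite prange in hb.
have ex i : {t | [/\ b <= t < b + 1, sk_curve K t = p i &
    forall u, b <= u < b + 1 -> sk_curve K u = p i -> t <= u]}.
  by apply: cid; apply: first_param => //; rewrite -prange; exists i.
pose f i := sval (ex i).
have fP i : [/\ b <= f i < b + 1, sk_curve K (f i) = p i &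
    forall u, b <= u < b + 1 -> sk_curve K u = p i -> f i <= u] by exact: svalP (ex i).
have finj : injective f.
  by move=> i j e; apply: pinj; have [_ <- _] := fP i; have [_ <- _] := fP j; rewrite e.
have [s [sinj ssurj smono]] := sort_injective finj.
have lab' : is_labelled_knot (sk_curve K) (p \o s).
  split=> //; first exact: inj_comp.
  rewrite -prange; apply/seteqP; split=> [_ [i _ <-]|_ [i _ <-]]; first by exists (s i).
  by have [j <-] := ssurj i; exists j.
have bas : is_based_knot (sk_curve K) (p \o s) b.
  split=> // i j ij; have [h1 h2 _] := fP (s i); exists (f (s i)); split=> // u hu cu.
  apply: lt_le_trans (smono _ _ ij) _; have [_ _ h] := fP (s j); exact: h.
by exists (BasedKnot bas).
Qed.
End BasedKnots.

(** * The cochain of a Vassiliev invariant *)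

Lemma class_ofP (T : choiceType) (r : T -> T -> Prop) (x y : T) :
  class_of r x = class_of r y <-> clos_refl_sym_trans T r x y.
Proof.
split=> [/eqmodP /asboolP //|h].
by apply/eqmodP/asboolP.
Qed.

Lemma class_of_representative (T : choiceType) (r : T -> T -> Prop) (k : classes r) : class_of r (representative k) = k.
Proof. exact: reprK. Qed.

Lemma class_of_map (T T' : choiceType) (r : T -> T -> Prop) (r' : T' -> T' -> Prop)
    (f : T -> T') (x y : T) :
  (forall u v, r u v -> r' (f u) (f v)) ->
  class_of r x = class_of r y -> class_of r' (f x) = class_of r' (f y).
Proof.
move=> hf /class_ofP h; apply/class_ofP.
elim: h => [u v /hf|u|u v _|u v w _ h1 _ h2]; [exact: rst_step|exact: rst_refl|exact: rst_sym|].
exact: rst_trans h1 h2.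
Qed.

(** * Isotopy classes, forgetful maps and extensions of invariants *)

Section KnotClasses.
Variables (R : realType) (M : oriented3manifold R).

Lemma label_isotopic_forget n (K K' : labelled_knot M n) :
  label_isotopic K K' -> isotopic (forget_label K) (forget_label K').
Proof.
move=> [G [P [[sG _] kG [G0 _] [G1 _]]]]; exists G; split=> // s hs.
by exists (P s); exact: kG.
Qed.

Lemma base_isotopic_forget n (K K' : based_knot M n) :
  base_isotopic K K' -> label_isotopic (forget_base K) (forget_base K').
Proof.
move=> [G [P [B [[sG sP _] kG [G0 P0 _] [G1 P1 _]]]]].
by exists G, P; split=> // s /kG [].
Qed.

Lemma singular_knot_eq n (K K' : singular_knot M n) :
  sk_curve K = sk_curve K' -> K = K'.
Proof.
case: K K' => c h [c' h'] /= e; subst c'; congr SingularKnot; exact: Prop_irrelevance.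
Qed.

(** [X_0_forget] goes through a chosen representative; an isotopy of labelled knots forgets to one
    of singular knots, so the choice is immaterial. *)
Lemma X_0_forget_class n (K : labelled_knot M n) :
  X_0_forget (class_of _ K) = class_of _ (forget_label K).
Proof.
apply: class_of_map (class_of_representative _); exact: label_isotopic_forget.
Qed.

Lemma X_b_forget_class n (K : based_knot M n) :
  X_b_forget (class_of _ K) = X_0_forget (class_of _ (forget_base K)).
Proof.
rewrite X_0_forget_class.
apply: (class_of_map (f := fun K => forget_label (forget_base K)))
  (class_of_representative _) => u v h.
exact/label_isotopic_forget/base_isotopic_forget.
Qed.

Lemma base_resolves_forget eps n (i : 'I_n.+1) (K : based_knot M n.+1) K' :
  base_resolves eps i K K' -> label_resolves eps i (forget_base K) (forget_base K').
Proof.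
move=> [G [P [B [[sG sP _] kG oG [G0 P0 _] [G1 P1 _]]]]].
by exists G, P; split=> // s /kG [].
Qed.

(** The interface through which the cohomological argument sees a complex; it lets both be treated
    at once. *)
Record resolvable (CK : knot_complex M) : Prop := {
  skein : forall phi psi, vassiliev_extension phi psi ->
    forall n (i : 'I_n.+1) (k : cell CK n.+1) kp km,
    cell_resolves true i k kp -> cell_resolves false i k km ->
    psi n.+1 (cell_forget k) = psi n (cell_forget kp) - psi n (cell_forget km);
  resolves : forall eps n (i : 'I_n.+1) (k : cell CK n.+1),
    exists k', cell_resolves eps i k k';
  forget_surj : forall n (x : X M n), exists k : cell CK n, cell_forget k = x }.

Lemma CK_0_resolvable : resolvable (CK_0 M).
Proof.
split.
- move=> phi psi [_ h] n i k kp km; exact: h.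
- move=> eps n i k; have [K' hK'] := label_resolution_exists eps i (representative k).
  exists (class_of _ K'), (representative k), K'; split=> //.
  by rewrite class_of_representative.
- move=> n x; have [p hp] := skP (representative x).
  exists (class_of _ (LabelledKnot hp)); rewrite /= X_0_forget_class.
  by rewrite -[RHS]class_of_representative; congr class_of; exact: singular_knot_eq.
Qed.

Lemma CK_b_resolvable : resolvable (CK_b M).
Proof.
split.
- move=> phi psi [_ h] n i k kp km [K [Kp [-> -> rp]]] [L [Lm [eL -> rm]]] /=.
  rewrite !X_b_forget_class; apply: (h n i) => /=.
    by exists (forget_base K), (forget_base Kp); split=> //; exact: base_resolves_forget.
  exists (forget_base L), (forget_base Lm); split=> //; last exact: base_resolves_forget.
  (* The positive and the negative resolution may start from different representatives of [k]; their
     labelled classes still agree. *)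
  exact: (class_of_map (@base_isotopic_forget _) eL).
- move=> eps n i k; have [K' hK'] := base_resolution_exists eps i (representative k).
  exists (class_of _ K'), (representative k), K'; split=> //.
  by rewrite class_of_representative.
- move=> n x; have [B hB] := based_knot_exists (representative x).
  exists (class_of _ B); rewrite /= X_b_forget_class X_0_forget_class.
  by rewrite -[RHS]class_of_representative; congr class_of; exact: singular_knot_eq.
Qed.

Lemma extension_unique phi psi psi' : vassiliev_extension phi psi ->
  vassiliev_extension phi psi' -> forall n (x : X M n), psi n x = psi' n x.
Proof.
move=> h h'; have rs := CK_0_resolvable; elim=> [|n ih] x; first by rewrite h.1 h'.1.
have [k <-] := forget_surj rs x.
have [kp hp] := resolves rs true ord0 k; have [km hm] := resolves rs false ord0 k.
by rewrite (skein rs h hp hm) (skein rs h' hp hm) !ih.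
Qed.

(** Each further double point expresses the value as a difference of two zeros; this makes the order
    filtration increasing. *)
Lemma extension_vanishes phi psi m n : vassiliev_extension phi psi -> (m <= n)%N ->
  (forall x : X M m, psi m x = 0) -> forall x : X M n, psi n x = 0.
Proof.
move=> h + h0; have rs := CK_0_resolvable.
elim: n => [|n ih]; first by rewrite leqn0 => /eqP <-.
rewrite leq_eqVlt => /orP[/eqP <- //|/ih {}ih] x.
have [k <-] := forget_surj rs x.
have [kp hp] := resolves rs true ord0 k; have [km hm] := resolves rs false ord0 k.
by rewrite (skein rs h hp hm) !ih subr0.
Qed.

End KnotClasses.

(** * Coboundaries of the restricted cochains *)

Section Cochains.
Variables (R : realType) (M : oriented3manifold R) (CK : knot_complex M).
Hypothesis rs : resolvable CK.
Variables (phi : X M 0 -> rat) (psi : forall n, X M n -> rat).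
Hypothesis hext : vassiliev_extension phi psi.

Local Notation f n := (restrict_cochain CK psi n).

Lemma fglift_linear (K : choiceType) (V : lmodType rat) (g : K -> V) :
  linear (fglift g : {freeg K / rat} -> V).
Proof.
have addg : {morph fglift g : x y / x - y} := lift_is_additive g.
pose G : {additive {freeg K / rat} -> V} := HB.pack (fglift g) (GRing.isAdditive.Build _ _ (fglift g) addg).
have GE x : fglift g x = G x by [].
have lc c D : fglift g (c *: D) = c *: fglift g D.
  rewrite -[D]freeg_sumE; elim: (dom D) => [|z s ih].
    by rewrite big_nil scaler0 GE raddf0 scaler0.
  rewrite big_cons scalerDr !GE !raddfD /= ih; congr (_ + _).
  have -> : c *: [freeg [:: (coeff z D, z)]] = [freeg [:: (c * coeff z D, z)]].
    by apply/eqP/freeg_eqP => x; rewrite coeffZ !coeffU mulrA.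
  by rewrite !liftU scalerA.
by move=> c u v; rewrite -lc !GE raddfD.
Qed.

Lemma restrict_cochain_linear n : linear (f n : chains CK n -> rat^o).
Proof. exact: fglift_linear. Qed.

Lemma restrict_cochain_basis n (k : cell CK n) :
  f n (basis_chain k) = psi (cell_forget k).
Proof. by rewrite /restrict_cochain /basis_chain liftU scale1r. Qed.

Lemma restrict_cochainD n (c d : chains CK n) : f n (c + d) = f n c + f n d.
Proof. by rewrite -[c]scale1r restrict_cochain_linear !scale1r. Qed.

Lemma restrict_cochainZ n a (c : chains CK n) : f n (a *: c) = a * f n c.
Proof.
have f0 : f n 0 = 0.
  by have := restrict_cochainD (0 : chains CK n) 0; rewrite addr0 => /eqP; rewrite eq_sym addrC -subr_eq0 addrK => /eqP.
by rewrite -[a *: c]addr0 restrict_cochain_linear f0 addr0.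
Qed.

Lemma restrict_cochain_sum n I (s : seq I) (F : I -> chains CK n) :
  f n (\sum_(j <- s) F j) = \sum_(j <- s) f n (F j).
Proof.
elim/big_rec2: _ => [|j y x _ <-]; last by rewrite restrict_cochainD.
by rewrite -(scale0r 0) restrict_cochainZ mul0r.
Qed.

(** Existence of both resolutions rules out the default value 0 in [resolution]; what remains is the
    skein relation. *)
Lemma restrict_cochain_dface n (i : 'I_n.+1) (k : cell CK n.+1) :
  f n (dface i k) = psi (cell_forget k).
Proof.
rewrite /dface /resolution; case: pselect => [ep|[]]; last exact: resolves.
case: pselect => [em|[]]; last exact: resolves.
rewrite -scaleN1r restrict_cochainD restrict_cochainZ mulN1r !restrict_cochain_basis.
by rewrite (skein rs hext (projT2 (cid ep)) (projT2 (cid em))).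
Qed.

Lemma coboundary_basis n (k : cell CK n.+1) :
  coboundary (f n) (basis_chain k) =
  \sum_(i < n.+1) (-1) ^+ i * psi (cell_forget k).
Proof.
rewrite /coboundary /= /boundary /basis_chain liftU scale1r restrict_cochain_sum.
by apply: eq_bigr => i _; rewrite restrict_cochainZ restrict_cochain_dface.
Qed.

Lemma alternating_sum n : \sum_(i < n) (-1) ^+ i = (odd n)%:R :> rat.
Proof.
elim: n => [|n ih]; first by rewrite big_ord0.
rewrite big_ord_recr /= ih -signr_odd; by case: (odd n).
Qed.

Lemma coboundary_restrict n (c : chains CK n.+1) :
  coboundary (f n) c = (odd n.+1)%:R * f n.+1 c.
Proof.
have lin : linear (coboundary (f n) : chains CK n.+1 -> rat^o).
  move=> a u v; rewrite /coboundary /= /boundary fglift_linear.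
  exact: restrict_cochain_linear.
rewrite -[c]freeg_sumE.
elim: (dom c) => [|z s ih].
  rewrite big_nil; have f0 : 0 = 0 *: 0 + 0 :> chains CK n.+1 by rewrite scale0r addr0.
  have := restrict_cochainZ 0 (0 : chains CK n.+1); rewrite scale0r mul0r => ->.
  have := lin (-1) 0 0; rewrite scaler0 addr0 scaleN1r addNr => ->.
  by rewrite mulr0.
rewrite big_cons restrict_cochainD.
have -> : [freeg [:: (coeff z c, z)]] = coeff z c *: basis_chain z :> chains CK n.+1.
  by apply/eqP/freeg_eqP => x; rewrite coeffZ !coeffU mul1r.
rewrite lin ih mulrDr coboundary_basis -mulr_suml alternating_sum restrict_cochainZ.
by rewrite restrict_cochain_basis [_ *: _]mulrCA.
Qed.

(** The value on a cell equals the value on each of its [dface]s, one of which is 0 when the cell is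
    degenerate. *)
Lemma restrict_cochain_relative n : relative_cochain (f n).
Proof.
split=> [|_ [s [hs ->]]]; first exact: restrict_cochain_linear.
rewrite restrict_cochain_sum big_seq big1 // => -[a k] /hs /=.
rewrite restrict_cochainZ restrict_cochain_basis.
case: n k {s hs} => [//|n] k [i hi].
by rewrite -(restrict_cochain_dface i) hi -(scale0r 0) restrict_cochainZ mul0r mulr0.
Qed.

Lemma nontrivial_even n : nontrivial_class (f n) -> ~~ odd n.
Proof.
move=> [_ h]; apply/negP => on; apply: h; case: n on => [//|n] on.
exists (f n); split=> [|c]; first exact: restrict_cochain_relative.
by rewrite coboundary_restrict on mul1r.
Qed.

Lemma nontrivial_vanishes n : nontrivial_class (f n) ->
  forall x : X M n.+1, psi x = 0.
Proof.
move=> h; have en := nontrivial_even h; case: h => -[_ h] _ x.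
have [k <-] := forget_surj rs x.
rewrite -restrict_cochain_basis.
by have := h (basis_chain k); rewrite coboundary_restrict /= en mul1r.
Qed.

Lemma nontrivial_neq0 n : nontrivial_class (f n) -> ~ forall x : X M n, psi x = 0.
Proof.
move=> [_ h] h0; apply: h.
have f0 c : f n c = 0.
  rewrite -[c]freeg_sumE restrict_cochain_sum big1 // => z _.
  by rewrite /restrict_cochain liftU h0 scaler0.
(* In degree 0 being a coboundary means being zero; in higher degrees zero is the coboundary of
   zero. *)
case: n h0 f0 => [//|n] h0 f0.
exists (cst 0); split=> [|c]; last by rewrite f0.
by split=> // a u v; rewrite /= scaler0 addr0.
Qed.

End Cochains.

Theorem corollary5p18 (R : realType) (M : oriented3manifold R)
  (hconn : connected [set: M])
  (hpi1 : pi_trivial R M 1) (hpi2 : pi_trivial R M 2)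
  (CK : knot_complex M) (hCK : CK = CK_0 M \/ CK = CK_b M)
  (phi : X M 0 -> rat) (phix : forall m : nat, X M m -> rat)
  (hext : vassiliev_extension phi phix)
  (N n : nat)
  (hN : vassiliev N%:Z phi) (hN1 : ~ vassiliev (N%:Z - 1) phi)
  (hclass : nontrivial_class (restrict_cochain CK phix n)) :
  N = n /\ exists k : nat, n = (2 * k)%N.
Proof.
have rs : resolvable CK.
  by case: hCK => ->; [exact: CK_0_resolvable|exact: CK_b_resolvable].
(* [hN] brings its own extension, which uniqueness identifies with [phix]. *)
have vN (x : X M N.+1) : phix N.+1 x = 0.
  have [psi [hpsi h0]] := hN.
  by rewrite (extension_unique hext hpsi) h0 // -addn1 PoszD.
split; last first.
  exists n./2; rewrite mul2n -[LHS]odd_double_half.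
  by rewrite (negbTE (nontrivial_even rs hext hclass)).
apply/eqP; rewrite eqn_leq; apply/andP; split; rewrite leqNgt; apply/negP => lt.
  (* If n < N, vanishing on (n+1)-singular knots spreads to N-singular ones, which is order at most
     N - 1. *)
  apply: hN1; exists phix; split=> // m.
  rewrite subrK => -[->] x.
  exact: extension_vanishes hext lt (nontrivial_vanishes rs hext hclass) x.
(* If N < n, the invariant already vanishes on n-singular knots, so its cochain is zero. *)
apply: nontrivial_neq0 hclass _ => x.
exact: extension_vanishes hext lt vN x.
Qed.
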